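(* Let $l\geq 2$ be an integer and let $g_1\geq 3$ be an odd integer. Let $H_2=(\mathbb{Z}/2\mathbb{Z})^l\times \mathbb{Z}/g_1\mathbb{Z}$. Then for every $\epsilon>0$, as $X\to\infty$, \[ N_{H_2}(X)=\#\{d\leq X:\ H_2\hookrightarrow \mathrm{Cl}(-d)\}\gg X^{\frac{1}{2}+\frac{3}{2g_1+2}-\epsilon}, \] where the implied constant may depend on $l$, $g_1$ and $\epsilon$.
   Context: Throughout, $d>1$ denotes a square-free positive integer, and $\mathrm{Cl}(-d)$ denotes the ideal class group of the imaginary quadratic field $\mathbb{Q}(\sqrt{-d})$. For a finite abelian group $H$ and $X>0$, $N_H(X)$ is the number of square-free integers $1<d\leq X$ such that there is an injective group homomorphism $H\hookrightarrow \mathrm{Cl}(-d)$. The notation $f(X)\gg g(X)$ means there is a constant $c>0$ with $f(X)\geq c\,g(X)$ for all sufficiently large $X$. *)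

(* Defs.v *)
From HB Require Import structures.
From mathcomp Require Import all_boot all_order all_algebra all_field.
From mathcomp Require Import generic_quotient ring.
From mathcomp Require Import boolp classical_sets reals topology normedtype exp.

Set Implicit Arguments.
Unset Strict Implicit.
Unset Printing Implicit Defensive.

Import Order.TTheory GRing.Theory Num.Theory.
Import numFieldNormedType.Exports.

Local Open Scope classical_set_scope.
Local Open Scope ring_scope.
Local Open Scope quotient_scope.

(* The field Q(sqrt(-d)), inside the field algC of algebraic numbers. *)
Definition quad_field (d : nat) : set algC :=
  [set z | exists a b : rat, z = ratr a + ratr b * sqrtC (- d%:R)].

Definition quad_int (d : nat) : set algC :=
  [set z | quad_field d z /\ z \in Aint].

Record is_frac_ideal (d : nat) (I : set algC) : Prop := IsFracIdeal {
  fi_field : I `<=` quad_field d;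
  fi_zero : I 0;
  fi_add : forall x y, I x -> I y -> I (x + y);
  fi_scale : forall a x, quad_int d a -> I x -> I (a * x);
  fi_nonzero : exists2 x, I x & x != 0;
  fi_denom : exists c, [/\ quad_int d c, c != 0 &
                           forall x, I x -> quad_int d (c * x)] }.

Record frac_ideal (d : nat) := FracIdeal {
  ideal_set :> set algC;
  ideal_setP : `[< is_frac_ideal d ideal_set >] }.

HB.instance Definition _ d := [isSub for @ideal_set d].
HB.instance Definition _ d := [Choice of frac_ideal d by <:].

Definition set_mul (I J : set algC) : set algC :=
  [set z | exists2 s : seq (algC * algC),
     (forall p, p \in s -> I p.1 /\ J p.2) & z = \sum_(p <- s) p.1 * p.2].

Definition principal_set (d : nat) (a : algC) : set algC :=
  [set a * x | x in quad_int d].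

Section QuadField.
Variable d : nat.
Local Notation K := (quad_field d).
Local Notation O := (quad_int d).
Local Notation s := (sqrtC (- d%:R) : algC).

Let sN : s ^* = - s.
Proof.
have /eqP : s^* ^+ 2 = s ^+ 2 by rewrite -rmorphXn /= !sqrtCK rmorphN rmorph_nat.
rewrite eqf_sqr => /orP[/eqP/CrealP sR|/eqP //].
have : 0 <= s ^+ 2 by rewrite real_exprn_even_ge0.
rewrite sqrtCK oppr_ge0 (_ : (_ <= 0 :> algC) = (d == 0)%N); last by rewrite lern0.
by move=> /eqP ->; rewrite oppr0 sqrtC0 rmorph0 oppr0.
Qed.

Let ss : s * s = - d%:R.
Proof. by rewrite -expr2 sqrtCK. Qed.

Let conjE (a b : rat) : (ratr a + ratr b * s)^* = ratr a - ratr b * s.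
Proof.
have ratc (c : rat) : (ratr c : algC)^* = ratr c by rewrite conj_Crat ?Crat_rat.
move: (ratc a) (ratc b); move: (ratr a : algC) (ratr b : algC) => u v uE vE.
by rewrite rmorphD rmorphM /= sN uE vE mulrN.
Qed.

Lemma quad_field_rat q : q \in Crat -> K q.
Proof. by move=> /CratP[a ->]; exists a, 0; rewrite rmorph0 mul0r addr0. Qed.

Lemma quad_fieldD x y : K x -> K y -> K (x + y).
Proof.
move=> [a [b ->]] [a' [b' ->]]; exists (a + a'), (b + b').
by rewrite !rmorphD /= mulrDl addrACA.
Qed.

Lemma quad_fieldM x y : K x -> K y -> K (x * y).
Proof.
move=> [a [b ->]] [a' [b' ->]].
exists (a * a' - d%:R * (b * b')), (a * b' + b * a').
rewrite !(rmorphD, rmorphN, rmorphM, rmorph_nat) /=.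
move: ss; move: (sqrtC _) => t tt.
have -> : d%:R = - (t * t) by rewrite tt opprK.
by ring.
Qed.

Lemma quad_field_conj x : K x -> K x^*.
Proof.
move=> [a [b ->]]; exists a, (- b).
by rewrite conjE rmorphN mulNr.
Qed.

Lemma quad_field_trace x : K x -> x + x^* \in Crat.
Proof.
move=> [a [b ->]]; rewrite conjE.
by rewrite addrACA subrr addr0 rpredD ?Crat_rat.
Qed.

Lemma quad_field_norm x : K x -> x * x^* \in Crat.
Proof.
move=> [a [b ->]]; rewrite conjE.
rewrite mulrC -subr_sqr [(_ * sqrtC _) ^+ 2]exprMn sqrtCK.
by apply: rpredB; [|apply: rpredM; [|rewrite rpredN rpred_nat]]; rewrite // rpredX ?Crat_rat.
Qed.

Lemma quad_fieldV x : K x -> K x^-1.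
Proof.
move=> Kx; have [->|x0] := eqVneq x 0; first by rewrite invr0; apply: quad_field_rat; rewrite rpred0.
have -> : x^-1 = (x * x^*)^-1 * x^*.
  by rewrite invfM -mulrA mulVf ?mulr1 ?conjC_eq0.
apply: quad_fieldM; last exact: quad_field_conj.
by apply: quad_field_rat; rewrite rpredV quad_field_norm.
Qed.

Lemma quad_int_int m : m \is a Num.int -> O m.
Proof.
move=> mZ; split; last exact: Aint_Cint.
by apply: quad_field_rat; case/intrP: mZ => k ->; rewrite rpred_int.
Qed.

Lemma quad_int1 : O 1. Proof. exact: quad_int_int. Qed.
Lemma quad_int0 : O 0. Proof. exact: quad_int_int. Qed.
Lemma quad_intD x y : O x -> O y -> O (x + y).
Proof. by move=> [? ?] [? ?]; split; [exact: quad_fieldD|exact: rpredD]. Qed.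
Lemma quad_intM x y : O x -> O y -> O (x * y).
Proof. by move=> [? ?] [? ?]; split; [exact: quad_fieldM|exact: rpredM]. Qed.
Lemma quad_int_conj x : O x -> O x^*.
Proof. by move=> [? ?]; split; [exact: quad_field_conj|rewrite Aint_aut]. Qed.

Lemma quad_int_crit x : K x -> x + x^* \is a Num.int ->
  x * x^* \is a Num.int -> O x.
Proof.
move=> Kx tZ nZ; split=> //.
pose p : {poly algC} := ('X - x%:P) * ('X - (x^*)%:P).
apply: (@root_monic_Aint p); first by rewrite rootM root_XsubC eqxx.
  by rewrite monicMl ?monicXsubC.
have -> : p = 'X^2 - (x + x^*)%:P * 'X + (x * x^*)%:P.
  by rewrite /p polyCD polyCM; ring.
apply/polyOverP => i; rewrite coefD coefB coefXn coefCM coefX coefC.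
have natZ (b : bool) : (b%:R : algC) \is a Num.int by rewrite rpred_nat.
apply: rpredD; last by case: eqP => _ //; rewrite rpred0.
by apply: rpredB; [|apply: rpredM].
Qed.

Lemma quad_int_rat x : O x -> x \in Crat -> x \is a Num.int.
Proof. by move=> [_ ?] ?; apply: Cint_rat_Aint. Qed.

Lemma set_mul_gen (I J : set algC) x y : I x -> J y -> set_mul I J (x * y).
Proof.
move=> Ix Jy; exists [:: (x, y)]; last by rewrite big_seq1.
by move=> p; rewrite inE => /eqP ->.
Qed.

Lemma set_mul_min (I J P : set algC) : P 0 ->
  (forall x y, P x -> P y -> P (x + y)) ->
  (forall x y, I x -> J y -> P (x * y)) -> set_mul I J `<=` P.
Proof.
move=> P0 PD PM z [r rIJ ->]; elim: r rIJ => [|p r IH] rIJ; first by rewrite big_nil.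
rewrite big_cons; apply: PD.
  by have [? ?] := rIJ p (mem_head _ _); apply: PM.
by apply: IH => q qr; apply: rIJ; rewrite inE qr orbT.
Qed.

Lemma set_mul0 (I J : set algC) : set_mul I J 0.
Proof. by exists [::]; rewrite ?big_nil. Qed.

Lemma set_mulD (I J : set algC) x y :
  set_mul I J x -> set_mul I J y -> set_mul I J (x + y).
Proof.
move=> [r rP ->] [t tP ->]; exists (r ++ t); last by rewrite big_cat.
by move=> p; rewrite mem_cat => /orP[/rP|/tP].
Qed.

Lemma set_mulC (I J : set algC) : set_mul I J = set_mul J I.
Proof.
have H (A B : set algC) : set_mul A B `<=` set_mul B A.
  apply: set_mul_min => [||x y Ax By]; [exact: set_mul0|exact: set_mulD|].
  by rewrite mulrC; apply: set_mul_gen.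
by rewrite eqEsubset; split.
Qed.

Lemma set_mulA (A B C : set algC) :
  set_mul A (set_mul B C) = set_mul (set_mul A B) C.
Proof.
rewrite eqEsubset; split; apply: set_mul_min; [exact: set_mul0|exact: set_mulD|
  |exact: set_mul0|exact: set_mulD|].
  move=> x y Ax; apply: (set_mul_min (P := [set y | set_mul (set_mul A B) C (x * y)])) => /=.
  - by rewrite mulr0; apply: set_mul0.
  - by move=> u v; rewrite mulrDr; apply: set_mulD.
  - by move=> u v Bu Cv; rewrite mulrA; apply: set_mul_gen => //; apply: set_mul_gen.
move=> x y + Cy; move: x; apply: (set_mul_min (P := [set x | set_mul A (set_mul B C) (x * y)])) => /=.
- by rewrite mul0r; apply: set_mul0.
- by move=> u v; rewrite mulrDl; apply: set_mulD.
- by move=> u v Au Bv; rewrite -mulrA; apply: set_mul_gen => //; apply: set_mul_gen.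
Qed.

Lemma set_mul_ideal I J : is_frac_ideal d I -> is_frac_ideal d J ->
  is_frac_ideal d (set_mul I J).
Proof.
move=> FI FJ; split.
- apply: set_mul_min; [by apply: quad_field_rat; rewrite rpred0|exact: quad_fieldD|].
  by move=> x y /(fi_field FI) ? /(fi_field FJ); apply: quad_fieldM.
- exact: set_mul0.
- exact: set_mulD.
- move=> a x Oa; move: x; apply: (set_mul_min (P := [set x | set_mul I J (a * x)])) => /=.
  + by rewrite mulr0; apply: set_mul0.
  + by move=> u v; rewrite mulrDr; apply: set_mulD.
  + by move=> u v Iu Jv; rewrite mulrA; apply: set_mul_gen => //; apply: (fi_scale FI).
- have [x Ix x0] := fi_nonzero FI; have [y Jy y0] := fi_nonzero FJ.
  by exists (x * y); [exact: set_mul_gen|rewrite mulf_neq0].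
- have [c [Oc c0 cI]] := fi_denom FI; have [e [Oe e0 eJ]] := fi_denom FJ.
  exists (c * e); split; [exact: quad_intM|by rewrite mulf_neq0|].
  apply: (set_mul_min (P := [set x | O (c * e * x)])) => /=.
  + by rewrite mulr0; apply: quad_int0.
  + by move=> u v; rewrite mulrDr; apply: quad_intD.
  + by move=> u v Iu Jv; rewrite mulrACA; apply: quad_intM; [exact: cI|exact: eJ].
Qed.

Lemma quad_field_frac x : K x -> exists c, [/\ O c, c != 0 & O (c * x)].
Proof.
move=> Kx.
have [t tE] := CratP _ (quad_field_trace Kx).
have [n nE] := CratP _ (quad_field_norm Kx).
pose m : algC := (denq t * denq n)%:~R.
have mZ : m \is a Num.int by rewrite intr_int.
have m0 : m != 0 by rewrite intr_eq0 mulf_neq0 ?denq_neq0.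
have mE : m^* = m by rewrite aut_intr.
have qZ (q : rat) : (denq q)%:~R * ratr q \is a @Num.int algC.
  by rewrite /ratr mulrC divfK ?intr_eq0 ?denq_neq0 // intr_int.
exists m; split; [exact: quad_int_int|exact: m0|].
apply: quad_int_crit.
- by apply: quad_fieldM => //; have [] := quad_int_int mZ.
- rewrite rmorphM /= mE -mulrDr tE /m intrM mulrAC.
  by rewrite rpredM ?qZ ?intr_int.
- rewrite rmorphM /= mE mulrACA nE -mulrA rpredM //.
  by rewrite /m intrM -mulrA rpredM ?qZ ?intr_int.
Qed.

Lemma principal_setP a : K a -> a != 0 -> is_frac_ideal d (principal_set d a).
Proof.
move=> Ka a0; split.
- by move=> _ [x [Kx _] <-]; apply: quad_fieldM.
- by exists 0; rewrite ?mulr0 //; apply: quad_int0.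
- by move=> _ _ [x Ox <-] [y Oy <-]; exists (x + y); rewrite ?mulrDr //; apply: quad_intD.
- by move=> b _ Ob [x Ox <-]; exists (b * x); [exact: quad_intM|rewrite mulrCA].
- by exists a => //; exists 1; rewrite ?mulr1 //; apply: quad_int1.
- have [c [Oc c0 Oca]] := quad_field_frac Ka; exists c; split=> //.
  by move=> _ [x Ox <-]; rewrite mulrA; apply: quad_intM.
Qed.

Lemma set_mul_principal a I : is_frac_ideal d I ->
  set_mul (principal_set d a) I = [set a * x | x in I].
Proof.
move=> FI; rewrite eqEsubset; split.
  apply: set_mul_min.
  - by exists 0; rewrite ?mulr0 //; apply: (fi_zero FI).
  - move=> _ _ [x Ix <-] [y Iy <-]; exists (x + y); rewrite ?mulrDr //.
    exact: (fi_add FI).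
  - by move=> _ y [x Ox <-] Iy; exists (x * y); rewrite ?mulrA //; apply: (fi_scale FI).
move=> _ [x Ix <-]; apply: set_mul_gen => //.
by exists 1; rewrite ?mulr1 //; apply: quad_int1.
Qed.

Lemma principal_set1 : principal_set d 1 = O.
Proof.
rewrite eqEsubset; split=> [_ [x Ox <-]|x Ox]; first by rewrite mul1r.
by exists x; rewrite ?mul1r.
Qed.

Lemma set_mul1 I : is_frac_ideal d I -> set_mul (principal_set d 1) I = I.
Proof.
move=> FI; rewrite set_mul_principal // eqEsubset; split=> [_ [x Ix <-]|x Ix].
  by rewrite mul1r.
by exists x; rewrite ?mul1r.
Qed.

(* The ideal generated by the products x y^* (x, y in I) meets Q in a cyclic
   group; with g a generator, that ideal is g O, so I^-1 = g^-1 I^*. *)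
Lemma frac_ideal_inv I : is_frac_ideal d I ->
  exists2 J, is_frac_ideal d J & set_mul I J = principal_set d 1.
Proof.
move=> FI; pose Ic : set algC := [set z | I z^*].
have FIc : is_frac_ideal d Ic.
  split; rewrite /Ic /=.
  - by move=> z /(fi_field FI)/quad_field_conj; rewrite conjCK.
  - by rewrite rmorph0; apply: (fi_zero FI).
  - by move=> x y; rewrite rmorphD; apply: (fi_add FI).
  - by move=> a x /quad_int_conj Oa; rewrite rmorphM; apply: (fi_scale FI).
  - have [x Ix x0] := fi_nonzero FI.
    by exists x^*; rewrite ?conjCK ?conjC_eq0.
  - have [c [Oc c0 cI]] := fi_denom FI; exists c^*; split.
    + exact: quad_int_conj.
    + by rewrite conjC_eq0.
    + by move=> x /cI /quad_int_conj; rewrite rmorphM /= conjCK.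
pose N := set_mul I Ic; have FN : is_frac_ideal d N by apply: set_mul_ideal.
have [c [Oc c0 cN]] := fi_denom FN.
pose n := c * c^*.
have nZ : n \is a Num.int.
  apply: quad_int_rat; first by apply: quad_intM => //; apply: quad_int_conj.
  by apply: quad_field_norm; case: Oc.
have n_gt0 : 0 < n by rewrite mul_conjC_gt0.
have n0 : n != 0 by rewrite gt_eqF.
have nN q : N q -> q \in Crat -> n * q \is a Num.int.
  move=> Nq Qq; apply: quad_int_rat.
    by rewrite /n mulrAC mulrC; apply: quad_intM; [exact: quad_int_conj|exact: cN].
  rewrite rpredM //.
  by apply: quad_field_norm; case: Oc.
have NB x y : N x -> N y -> N (x - y).
  move=> Nx Ny; apply: (fi_add FN) => //; rewrite -mulN1r.
  by apply: (fi_scale FN) => //; apply: quad_int_int; rewrite rpredN1.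
have ex : exists k : nat, `[< N (k.+1%:R / n) >].
  have [x Ix x0] := fi_nonzero FI.
  have Nx : N (x * x^*) by apply: set_mul_gen => //; rewrite /Ic /= conjCK.
  have := nN _ Nx (quad_field_norm (fi_field FI Ix)) => /intrP[k kE].
  have k0 : (0 < k)%R.
    by rewrite -(ltr0z algC) -kE mulr_gt0 // mul_conjC_gt0.
  case: k k0 kE => // -[//|k] _ kE; exists k; apply/asboolP.
  by rewrite pmulrn -kE mulrAC divff // mul1r.
case: (ex_minnP ex) => k /asboolP Nk kmin.
pose g : algC := k.+1%:R / n.
have g0 : g != 0 by rewrite mulf_neq0 ?invr_eq0 ?pnatr_eq0.
have nQ : n \in Crat by case/intrP: nZ => j ->; rewrite rpred_int.
have gQ : g \in Crat by rewrite rpred_div ?rpred_nat.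
have gc : g^* = g by rewrite conj_Crat.
have Ng q : N q -> q \in Crat -> q / g \is a Num.int.
  move=> Nq Qq; have /intrP[z zE] := nN q Nq Qq.
  have qE : q = z%:~R / n by rewrite -zE mulrAC divff // mul1r.
  have dv := divz_eq z k.+1%:Z.
  have Nr : N ((z %% k.+1%:Z)%Z%:~R / n).
    have -> : (z %% k.+1%:Z)%Z%:~R / n = q - (z %/ k.+1%:Z)%Z%:~R * g.
      have zE' : z%:~R = (z %/ k.+1%:Z)%Z%:~R * k.+1%:R + (z %% k.+1%:Z)%Z%:~R :> algC.
        by rewrite {1}dv rmorphD rmorphM.
      by rewrite qE zE' /g; ring.
    apply: NB => //; apply: (fi_scale FN) => //.
    by apply: quad_int_int; rewrite intr_int.
  have r_ge0 : 0 <= (z %% k.+1%:Z)%Z by rewrite modz_ge0.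
  have r_lt : ((z %% k.+1%:Z)%Z < k.+1%:Z) by rewrite ltz_pmod.
  move: dv Nr r_ge0 r_lt; case: (z %% k.+1%:Z)%Z => // -[|r] dv Nr _ r_lt.
    rewrite qE dv addr0 intrM /g invf_div mulrA divfK //.
    by rewrite -mulrA divff ?mulr1 ?intr_int // intr_eq0.
  have /kmin : `[< N (r.+1%:R / n) >] by apply/asboolP.
  by move: r_lt; rewrite ltz_nat ltnS => h /(leq_trans h); rewrite ltnn.
have Og a b : I a -> I b -> O (a * b^* / g).
  move=> Ia Ib; have Ka := fi_field FI Ia; have Kb := fi_field FI Ib.
  have Nab : N (a * b^*) by apply: set_mul_gen; rewrite /Ic /= ?conjCK.
  have Nba : N (b * a^*) by apply: set_mul_gen; rewrite /Ic /= ?conjCK.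
  have Kab : K (a * b^*) by apply: quad_fieldM => //; apply: quad_field_conj.
  apply: quad_int_crit.
  - by apply: quad_fieldM => //; apply: quad_field_rat; rewrite rpredV.
  - rewrite rmorphM fmorphV /= gc -mulrDl; apply: Ng.
      by apply: (fi_add FN) => //; rewrite rmorphM /= conjCK mulrC.
    exact: quad_field_trace.
  - have Nxx x : I x -> x * x^* / g \is a Num.int.
      move=> Ix; apply: Ng; last by apply: quad_field_norm; apply: (fi_field FI).
      by apply: set_mul_gen; rewrite /Ic /= ?conjCK.
    rewrite !rmorphM fmorphV /= gc conjCK.
    have -> : a * b^* / g * (a^* * b / g) = (a * a^* / g) * (b * b^* / g).
      rewrite ![_ / g * (_ / g)]mulrACA; congr (_ * _).
      by rewrite mulrACA [b^* * b]mulrC.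
    by rewrite rpredM ?Nxx.
pose J : set algC := [set z | Ic (g * z)].
have FJ : is_frac_ideal d J.
  split; rewrite /J /=.
  - move=> z /(fi_field FIc) Kgz; rewrite -(mulKf g0 z).
    by apply: quad_fieldM => //; apply: quad_field_rat; rewrite rpredV.
  - by rewrite mulr0; apply: (fi_zero FIc).
  - by move=> x y; rewrite mulrDr; apply: (fi_add FIc).
  - by move=> a x Oa; rewrite mulrCA; apply: (fi_scale FIc).
  - have [x Ix x0] := fi_nonzero FIc; exists (x / g).
      by rewrite mulrC divfK.
    by rewrite mulf_neq0 ?invr_eq0.
  - have [e [Oe e0 eI]] := fi_denom FIc.
    have gVQ : g^-1 \in Crat by rewrite rpredV.
    have [f [Of f0 Ofg]] := quad_field_frac (quad_field_rat gVQ).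
    exists (e * f); split; [exact: quad_intM|by rewrite mulf_neq0|].
    move=> x /eI Oegx.
    have -> : e * f * x = (f / g) * (e * (g * x)).
      by field.
    by apply: quad_intM.
exists J => //; rewrite principal_set1 eqEsubset; split.
  apply: set_mul_min; [exact: quad_int0|exact: quad_intD|].
  move=> x z Ix Jz; have := Og _ _ Ix Jz; rewrite conjCK.
  by have -> : x * (g * z) / g = x * z by field.
move=> x Ox; rewrite -(mulr1 x); apply: (fi_scale (set_mul_ideal FI FJ)) => //.
have -> : 1 = g^-1 * g by rewrite mulVf.
move: Nk; rewrite -/g; move: {-2}g => y.
apply: (set_mul_min (P := [set y | set_mul I J (g^-1 * y)])) => /=.
- by rewrite mulr0; apply: set_mul0.
- by move=> u v; rewrite mulrDr; apply: set_mulD.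
- move=> u v Iu Iv; rewrite mulrCA; apply: set_mul_gen => //.
  by rewrite /J /= mulVKf.
Qed.

End QuadField.

Section ClassGroup.
Variable d : nat.
Implicit Types I J L : frac_ideal d.

Lemma frac_idealP I : is_frac_ideal d I.
Proof. exact/asboolP/ideal_setP. Qed.

Definition ideal_mul I J : frac_ideal d :=
  FracIdeal (asboolT (set_mul_ideal (frac_idealP I) (frac_idealP J))).

Definition principal (a : algC) (Ka : quad_field d a) (a0 : a != 0) :
    frac_ideal d :=
  FracIdeal (asboolT (principal_setP Ka a0)).

Definition unit_ideal : frac_ideal d :=
  principal (proj1 (quad_int1 d)) (oner_neq0 _).

Lemma ideal_mulA : associative ideal_mul.
Proof. by move=> I J L; apply/val_inj; apply: set_mulA. Qed.

Lemma ideal_mulC : commutative ideal_mul.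
Proof. by move=> I J; apply/val_inj; apply: set_mulC. Qed.

Lemma ideal_mul1 : left_id unit_ideal ideal_mul.
Proof. by move=> I; apply/val_inj/set_mul1/frac_idealP. Qed.

Lemma ideal_inv_subproof I : {J | ideal_mul I J = unit_ideal}.
Proof.
apply: cid; have [J FJ IJ] := frac_ideal_inv (frac_idealP I).
by exists (FracIdeal (asboolT FJ)); apply/val_inj.
Qed.

Definition ideal_inv I : frac_ideal d := sval (ideal_inv_subproof I).

Lemma ideal_mulV I : ideal_mul I (ideal_inv I) = unit_ideal.
Proof. exact: svalP (ideal_inv_subproof I). Qed.

Definition is_principal I :=
  exists a (Ka : quad_field d a) (a0 : a != 0), I = principal Ka a0.

Definition ideal_equiv : rel (frac_ideal d) :=
  fun I J => `[< is_principal (ideal_mul I (ideal_inv J)) >].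

Lemma principal_eq a b (Ka : quad_field d a) (Kb : quad_field d b) a0 b0 :
  a = b -> principal Ka a0 = principal Kb b0.
Proof. by move=> ab; apply/val_inj; rewrite /= ab. Qed.

Lemma principalM a b (Ka : quad_field d a) (Kb : quad_field d b) a0 b0 :
  ideal_mul (principal Ka a0) (principal Kb b0) =
  principal (quad_fieldM Ka Kb) (mulf_neq0 a0 b0).
Proof.
apply/val_inj => /=; rewrite set_mul_principal; last exact: principal_setP.
rewrite eqEsubset; split=> [_ [_ [x Ox <-] <-]|_ [x Ox <-]].
  by exists x; rewrite ?mulrA.
by exists (b * x); [exists x|rewrite mulrA].
Qed.

Lemma is_principal1 : is_principal unit_ideal.
Proof. by exists 1, (proj1 (quad_int1 d)), (oner_neq0 _). Qed.

Lemma is_principalM I J :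
  is_principal I -> is_principal J -> is_principal (ideal_mul I J).
Proof.
move=> [a [Ka [a0 ->]]] [b [Kb [b0 ->]]].
by rewrite principalM; exists (a * b), (quad_fieldM Ka Kb), (mulf_neq0 a0 b0).
Qed.

Lemma ideal_inv_uniq I J : ideal_mul I J = unit_ideal -> ideal_inv I = J.
Proof.
move=> IJ; rewrite -[LHS]ideal_mul1 -IJ [ideal_mul I J]ideal_mulC.
by rewrite -ideal_mulA ideal_mulV ideal_mulC ideal_mul1.
Qed.

Lemma is_principalV I : is_principal I -> is_principal (ideal_inv I).
Proof.
move=> [a [Ka [a0 ->]]]; have a0' : a^-1 != 0 by rewrite invr_eq0.
exists a^-1, (quad_fieldV Ka), a0'; apply: ideal_inv_uniq.
by rewrite principalM; apply: principal_eq; rewrite mulfV.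
Qed.

Lemma ideal_invM I J :
  ideal_inv (ideal_mul I J) = ideal_mul (ideal_inv I) (ideal_inv J).
Proof.
apply: ideal_inv_uniq; rewrite -ideal_mulA [ideal_mul J _]ideal_mulC.
rewrite -[ideal_mul (ideal_mul _ _) J]ideal_mulA [ideal_mul _ J]ideal_mulC.
by rewrite ideal_mulV [ideal_mul _ unit_ideal]ideal_mulC ideal_mul1 ideal_mulV.
Qed.

Lemma ideal_invK I : ideal_inv (ideal_inv I) = I.
Proof. by apply: ideal_inv_uniq; rewrite ideal_mulC ideal_mulV. Qed.

Lemma ideal_equiv_refl : reflexive ideal_equiv.
Proof. by move=> I; apply/asboolP; rewrite ideal_mulV; apply: is_principal1. Qed.

Lemma ideal_equiv_sym : symmetric ideal_equiv.
Proof.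
have H I J : ideal_equiv I J -> ideal_equiv J I.
  move=> /asboolP/is_principalV; rewrite ideal_invM ideal_invK ideal_mulC.
  by move=> ?; apply/asboolP.
by move=> I J; apply/idP/idP; apply: H.
Qed.

Lemma ideal_equiv_trans : transitive ideal_equiv.
Proof.
move=> J I L /asboolP IJ /asboolP JL; apply/asboolP.
have := is_principalM IJ JL; rewrite -ideal_mulA.
rewrite [ideal_mul (ideal_inv J) _]ideal_mulA [ideal_mul (ideal_inv J) J]ideal_mulC.
by rewrite ideal_mulV ideal_mul1.
Qed.

Canonical ideal_equiv_rel :=
  EquivRel ideal_equiv ideal_equiv_refl ideal_equiv_sym ideal_equiv_trans.

(* The ideal class group Cl(-d): fractional ideals modulo principal ones.  It is
   written additively, to be a zmodType: the sum of two classes is the class of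
   the product of the ideals. *)
Definition class_group : Type := {eq_quot ideal_equiv}.
HB.instance Definition _ := Choice.on class_group.

Definition ideal_class I : class_group := \pi_{eq_quot ideal_equiv} I.
Definition class_repr (x : class_group) : frac_ideal d :=
  repr (x : {eq_quot ideal_equiv}).

Lemma class_reprK x : ideal_class (class_repr x) = x.
Proof. exact: reprK. Qed.

Lemma ideal_classP I J : (ideal_class I = ideal_class J) <-> ideal_equiv I J.
Proof. by split=> [/eqmodP|h]; [|apply/eqmodP]. Qed.

Definition class_add (x y : class_group) : class_group :=
  ideal_class (ideal_mul (class_repr x) (class_repr y)).
Definition class_opp (x : class_group) : class_group :=
  ideal_class (ideal_inv (class_repr x)).
Definition class_zero : class_group := ideal_class unit_ideal.

Lemma class_addE I J :
  class_add (ideal_class I) (ideal_class J) = ideal_class (ideal_mul I J).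
Proof.
have /ideal_classP/asboolP pI := class_reprK (ideal_class I).
have /ideal_classP/asboolP pJ := class_reprK (ideal_class J).
apply/ideal_classP/asboolP; have := is_principalM pI pJ.
move: (class_repr _) (class_repr _) => A B.
rewrite ideal_invM -!ideal_mulA; congr (is_principal (ideal_mul _ _)).
by rewrite !ideal_mulA [ideal_mul (ideal_inv _) _]ideal_mulC.
Qed.

Lemma class_addA : associative class_add.
Proof.
move=> x y z; rewrite -(class_reprK x) -(class_reprK y) -(class_reprK z).
by rewrite !class_addE ideal_mulA.
Qed.

Lemma class_addC : commutative class_add.
Proof. by move=> x y; rewrite /class_add ideal_mulC. Qed.

Lemma class_add0 : left_id class_zero class_add.
Proof. by move=> x; rewrite -(class_reprK x) class_addE ideal_mul1. Qed.

Lemma class_addN : left_inverse class_zero class_opp class_add.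
Proof.
move=> x; rewrite class_addC -{1}(class_reprK x) class_addE.
by rewrite ideal_mulV.
Qed.

HB.instance Definition _ := GRing.isZmodule.Build class_group
  class_addA class_addC class_add0 class_addN.

End ClassGroup.

Definition squarefree (n : nat) : Prop :=
  forall m : nat, (m ^ 2 %| n)%N -> m = 1%N.

Definition embeds (G H : zmodType) : Prop :=
  exists f : {additive G -> H}, injective f.

Definition class_count (R : realType) (H : zmodType) (X : R) : nat :=
  (\sum_(2 <= d < (Num.truncn X).+1 |
      `[< squarefree d /\ embeds H (class_group d) >]) 1)%N.

Definition eventually_gg (R : realType) (f g : R -> R) : Prop :=
  exists2 c : R, 0 < c & \forall X \near +oo, c * g X <= f X.

(* Main.v *)
(** Let [g] be odd and suppose [m^g = n^2 + y^2 d] with [d] squarefree, [m] coprime to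
    [2 n] and [64 m^g < d^3].  Then the ideal [(m, n + y sqrt(-d))] has [g]-th power
    [(n + y sqrt(-d))], and its class has order exactly [g] since a non-rational integer
    of the field has norm at least [d/4].  If moreover [l] distinct primes with product
    smaller than [d] divide [d], the ramified primes above them generate a subgroup
    [(Z/2)^l] of the class group.

    It remains to produce many such [d], following Soundararajan.  Fix a large
    [k] and let all parameters be powers of [B = X^(1/K)], where [K] is about [(4g+4)k];
    a bound [tau <= B] for the divisor function then costs only a factor [X^eps].  Take
    [m = a b] for primes [a, b] of size [B^(3k)], [n] of size [B^(3gk)], and require that
    [m^g - n^2] be divisible by the square of a prime [t] of size [B^((g-2)k)] and,
    exactly once, by each of [l] fixed primes.  For each [t] a positive proportion of the
    products [a b] are squares modulo [t], because two primes whose discrete logarithms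
    have the same parity multiply to a square.  Let [d] be the squarefree part of
    [m^g - n^2 = y^2 d].  Pairs with [y] much larger than [t] are rare: for medium [y] one
    counts square roots of [m^g] modulo [y^2], for large [y] coprime representations of
    [m^g] by the form [n^2 + d y^2].  Finally two pairs with the same [d] give a
    factorisation of [y2^2 m1^g - y1^2 m2^g], so collisions are few, and Cauchy-Schwarz
    bounds the number of distinct [d] from below. *)

Require Import Defs.
From HB Require Import structures.
From mathcomp Require Import all_boot all_order all_algebra all_fingroup all_field.
From mathcomp Require Import cyclic ring lra zify.

Set Implicit Arguments.
Unset Strict Implicit.
Unset Printing Implicit Defensive.

Import Order.TTheory GRing.Theory Num.Theory.

Local Open Scope nat_scope.

(** * The divisor function *)

Definition tau n := size (divisors n).

Lemma size_le_tau (T : eqType) (s : seq T) (f : T -> nat) (n : nat) :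
  0 < n -> uniq s -> {in s &, injective f} -> (forall x, x \in s -> f x %| n) ->
  size s <= tau n.
Proof.
move=> n0 us finj fd; rewrite -(size_map f); apply: uniq_leq_size.
  by rewrite map_inj_in_uniq.
by move=> _ /mapP[x xs ->]; rewrite -dvdn_divisors // fd.
Qed.

(** A divisor [x] of [m * n] is recovered from [gcdn x m] and [x %/ gcdn x m]; the latter is coprime
    to [m %/ gcdn x m], hence divides [n]. *)
Lemma tau_mul_le m n : 0 < m -> 0 < n -> tau (m * n) <= tau m * tau n.
Proof.
move=> m0 n0; rewrite /tau -(size_allpairs pair) -(size_map (fun x => (gcdn x m, x %/ gcdn x m))).
have mn0 : 0 < m * n by rewrite muln_gt0 m0.
apply: uniq_leq_size.
  rewrite map_inj_in_uniq ?divisors_uniq // => x y _ _ [e1 e2].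
  by rewrite -(divnK (dvdn_gcdl x m)) -(divnK (dvdn_gcdl y m)) e2 e1.
move=> _ /mapP[x xd ->]; rewrite -dvdn_divisors // in xd.
apply/allpairsP; exists (gcdn x m, x %/ gcdn x m); split=> //=.
  by rewrite -dvdn_divisors // dvdn_gcdr.
have g0 : 0 < gcdn x m by rewrite gcdn_gt0 m0 orbT.
rewrite -dvdn_divisors // -(@Gauss_dvdr _ (m %/ gcdn x m)); last first.
  by rewrite /coprime -(@eqn_pmul2r (gcdn x m)) // muln_gcdl !divnK ?dvdn_gcdl ?dvdn_gcdr // mul1n.
by rewrite -(@dvdn_pmul2r (gcdn x m)) // divnK ?dvdn_gcdl // mulnAC divnK // dvdn_gcdr.
Qed.

Lemma tau_prime_exp p e : prime p -> tau (p ^ e) <= e.+1.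
Proof.
move=> pp; rewrite -(size_iota 0 e.+1) -(size_map (expn p)).
apply: uniq_leq_size; first exact: divisors_uniq.
move=> x; rewrite -dvdn_divisors ?expn_gt0 ?prime_gt0 // => /(dvdn_pfactor _ _ pp)[i ie ->].
by apply: map_f; rewrite mem_iota.
Qed.

(** For positive [k], this is [e + 1 <= k * 2 ^ (e %/ k)] raised to the power [k]. *)
Lemma succ_exp_le k e : e.+1 ^ k <= k ^ k * 2 ^ e.
Proof.
case: k => [|k]; first by rewrite !expn0 mul1n expn_gt0.
have le1 : e.+1 <= k.+1 * 2 ^ (e %/ k.+1).
  apply: leq_trans (leq_mul (leqnn _) (ltn_expl _ (ltnSn 1))).
  by rewrite {1}(divn_eq e k.+1) mulnS mulnC; have := ltn_pmod e (ltn0Sn k); lia.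
apply: leq_trans (_ : (k.+1 * 2 ^ (e %/ k.+1)) ^ k.+1 <= _); first by rewrite leq_exp2r.
by rewrite expnMn leq_mul2l -expnM leq_exp2l // leq_divM orbT.
Qed.

(* Primes [p >= 2^k] contribute [(e+1)^k <= p^e], so only the finitely many smaller
   ones cost a constant. *)
Lemma tau_exp_le k : exists2 C, 0 < C & forall n, 0 < n -> tau n ^ k <= C * n.
Proof.
have C0 : 0 < k ^ k by case: k => // k; rewrite expn_gt0.
exists ((k ^ k) ^ (2 ^ k)) => [|n n0]; first by rewrite expn_gt0 C0.
(* The constant is charged once for each prime below [2 ^ k] dividing [n]. This sharper form passes
   through the induction that strips the least prime factor with its full power. *)
suff H : tau n ^ k <= (k ^ k) ^ (count (fun p => p %| n) [seq p <- iota 0 (2 ^ k) | prime p]) * n.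
  apply: leq_trans H _; rewrite leq_mul2r leq_pexp2l ?orbT //.
  by apply: leq_trans (count_size _ _) _; rewrite size_filter (leq_trans (count_size _ _)) ?size_iota.
elim/ltn_ind: n n0 => n IH n0.
have [n1|n1] := leqP n 1.
  have -> : n = 1 by lia.
  by rewrite /tau /= exp1n muln1 expn_gt0 C0.
pose p := pdiv n; have pp : prime p := pdiv_prime n1.
pose e := logn p n; pose n' := n %/ p ^ e.
have nE : n = n' * p ^ e by rewrite divnK // pfactor_dvdnn.
have e0 : 0 < e by rewrite logn_gt0 mem_primes pp n0 pdiv_dvd.
have pe1 : 1 < p ^ e by rewrite -(exp1n e) ltn_exp2r // prime_gt1.
have n'0 : 0 < n' by rewrite nE muln_gt0 in n0; case/andP: n0.
have lt : n' < n by rewrite [X in _ < X]nE -[X in X < _]muln1 ltn_pmul2l.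
have pn' : ~~ (p %| n').
  apply/negP => pd; have : p ^ e.+1 %| n by rewrite nE expnS dvdn_mul.
  by rewrite pfactor_dvdn // ltnn.
have t1 : tau n ^ k <= tau n' ^ k * e.+1 ^ k.
  rewrite -expnMn; case: (k) => // k'; rewrite leq_exp2r // {1}nE.
  apply: leq_trans (tau_mul_le n'0 (ltnW pe1)) _.
  by rewrite leq_mul2l tau_prime_exp // orbT.
apply: leq_trans t1 _; have {}IH := IH _ lt n'0.
have cnt_le : count (fun q => q %| n') [seq q <- iota 0 (2 ^ k) | prime q]
       + (p < 2 ^ k) <= count (fun q => q %| n) [seq q <- iota 0 (2 ^ k) | prime q].
  set r := [seq q <- _ | _].
  have -> : count (fun q => q %| n') r + (p < 2 ^ k) =
            count (fun q => q %| n') r + count (pred1 p) r.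
    rewrite count_uniq_mem ?filter_uniq ?iota_uniq // mem_filter pp mem_iota.
    by rewrite add0n /=.
  rewrite -count_predUI [X in _ + X](_ : _ = 0) ?addn0.
    apply: sub_count => q /= /orP[|/eqP->]; first by move=> h; rewrite nE dvdn_mulr.
    exact: pdiv_dvd.
  apply/eqP; rewrite -leqn0 leqNgt -has_count; apply/hasP => -[q _ /= /andP[h /eqP E]].
  by rewrite -E h in pn'.
have step : e.+1 ^ k <= (k ^ k) ^ (p < 2 ^ k) * p ^ e.
  have [pl|pl] := ltnP p (2 ^ k).
    rewrite expn1; apply: leq_trans (succ_exp_le k e) _.
    by rewrite leq_mul2l leq_exp2r // prime_gt1 ?orbT.
  rewrite mul1n; apply: leq_trans (_ : (2 ^ e) ^ k <= _).
    by case: (k) => // k'; rewrite leq_exp2r // ltn_expl.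
  by rewrite -expnM mulnC expnM leq_exp2r.
apply: leq_trans (leq_mul IH step) _.
rewrite mulnACA -nE -expnD leq_mul2r; apply/orP; right.
by rewrite leq_pexp2l.
Qed.

(** Using the exponent [J.+1] leaves one spare factor [B] to absorb the constant. *)
Lemma tau_le_base J : exists B0, forall B n, B0 <= B -> 0 < n -> n <= B ^ J -> tau n <= B.
Proof.
have [C C0 H] := tau_exp_le J.+1; exists C => B n CB n0 nB.
rewrite -(@leq_exp2r _ _ J.+1) //; apply: leq_trans (H n n0) _.
by rewrite expnS leq_mul.
Qed.

(** * A lower bound for the number of primes *)

Lemma bin_double_ge n : 2 ^ n <= 'C(n.*2, n).
Proof.
elim: n => [|n IH]; first by rewrite bin0.
rewrite doubleS binS; apply: leq_trans (_ : 'C(n.*2, n) + 'C(n.*2, n) <= _).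
  by rewrite addnn -muln2 expnSr leq_mul2r IH orbT.
apply: leq_add; first by rewrite binS leq_addl.
by case: (n) => [|n']; rewrite ?bin0 // binS leq_addr.
Qed.

(** By Legendre's formula the exponent is a sum of differences [n.*2 %/ p ^ k - 2 * (n %/ p ^ k)].
    Each is 0 or 1, and it vanishes once [p ^ k] exceeds [n.*2]. *)
Lemma logn_bin_double p n : prime p -> 0 < n -> p ^ logn p 'C(n.*2, n) <= n.*2.
Proof.
move=> pp n0; have n2 : 0 < n.*2 by rewrite double_gt0.
apply: leq_trans (trunc_logP (prime_gt1 pp) n2).
rewrite leq_exp2l ?prime_gt1 //.
have nn : n <= n.*2 by lia.
have := congr1 (logn p) (bin_fact nn).
rewrite (_ : n.*2 - n = n); last by lia.
rewrite !lognM ?muln_gt0 ?fact_gt0 ?bin_gt0 // !logn_fact //.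
have ext : \sum_(1 <= k < n.+1) n %/ p ^ k = \sum_(1 <= k < n.*2.+1) n %/ p ^ k.
  have n12 : n.+1 <= n.*2.+1 by lia.
  rewrite [RHS](big_cat_nat (ltn0Sn n) n12) /=.
  rewrite [X in _ = _ + X](_ : _ = 0) ?addn0 // big_nat_cond.
  rewrite big1 // => k; rewrite andbT => /andP[nk _].
  by rewrite divn_small // (leq_trans nk) // ltnW // ltn_expl // prime_gt1.
rewrite ext => H.
suff : \sum_(1 <= k < n.*2.+1) n.*2 %/ p ^ k <=
       \sum_(1 <= k < n.*2.+1) ((n %/ p ^ k) + (n %/ p ^ k) + (k <= trunc_log p n.*2)).
  rewrite !big_split /= -H addnC leq_add2l => /leq_trans; apply.
  rewrite -(big_mkcond (fun k => k <= trunc_log p n.*2) (fun _ => 1)) /= sum1_count.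
  rewrite -size_filter -[X in _ <= X](size_iota 1); apply: uniq_leq_size.
    by rewrite filter_uniq ?iota_uniq.
  by move=> k; rewrite mem_filter mem_index_iota mem_iota; lia.
apply: leq_sum => k _; have q0 : 0 < p ^ k by rewrite expn_gt0 prime_gt0.
have [le|gt] := leqP (p ^ k) n.*2; last by rewrite divn_small.
rewrite (trunc_log_max (prime_gt1 pp) le) -ltnS ltn_divLR //.
by rewrite {1}(divn_eq n (p ^ k)); have := ltn_pmod n q0; nia.
Qed.

Lemma prime_dvd_fact_le p n : prime p -> p %| n`! -> p <= n.
Proof.
move=> pp; elim: n => [|n IH]; first by rewrite dvdn1 => /eqP p1; rewrite p1 in pp.
rewrite factS Euclid_dvdM // => /orP[/dvdn_leq -> //|/IH/leqW //].
Qed.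

Lemma bin_double_le n : 0 < n -> 'C(n.*2, n) <= n.*2 ^ count prime (iota 0 n.*2.+1).
Proof.
move=> n0; have nn : n <= n.*2 by lia.
have C0 : 0 < 'C(n.*2, n) by rewrite bin_gt0.
rewrite {1}(prod_prime_decomp C0) prime_decompE big_map /=.
apply: leq_trans (_ : \prod_(p <- primes 'C(n.*2, n)) n.*2 <= _).
  rewrite !big_seq; apply: leq_prod => p; rewrite mem_primes => /andP[pp _].
  exact: logn_bin_double.
rewrite big_const_seq iter_muln_1 leq_pexp2l ?double_gt0 //.
apply: leq_trans (count_size _ _) _; rewrite -size_filter; apply: uniq_leq_size.
  exact: primes_uniq.
move=> p; rewrite mem_primes mem_filter mem_iota => /and3P[pp _ pd].
rewrite pp prime_gt0 //= ltnS; apply: prime_dvd_fact_le => //.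
by rewrite -(bin_fact nn) dvdn_mulr.
Qed.

Lemma exp_lt_pow2 k : exists B0, forall B, B0 <= B -> B ^ k < 2 ^ B.
Proof.
exists (k.+1 ^ k.+1) => B CB; have := succ_exp_le k.+1 B.
have B0 : 0 < B by apply: leq_trans CB; rewrite expn_gt0.
have lt : B ^ k * B < B.+1 ^ k.+1 by rewrite -expnSr ltn_exp2r.
move=> /(leq_trans lt); rewrite mulnC => h.
by rewrite -(ltn_pmul2l B0); apply: leq_trans h _; rewrite leq_mul2r CB orbT.
Qed.

(** Chebyshev's argument with the central binomial coefficient. With [x = B ^ j.+1], fewer than
    [B ^ j] primes would give [2 ^ x <= x ^ (3 * B ^ j)], that is [2 ^ B <= B ^ (3 * j.+1)] after
    taking a root. *)
Lemma count_prime_ge j : exists B0, forall B, B0 <= B ->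
  B ^ j <= count prime (iota 0 (B ^ j.+1).+1).
Proof.
have [B0 HB] := exp_lt_pow2 (3 * j.+1); exists (maxn B0 2) => B.
rewrite geq_max => /andP[/HB lt B2]; rewrite leqNgt; apply/negP => cnt.
pose x := B ^ j.+1; pose n := x./2.
have x2 : 2 <= x by rewrite /x expnS (leq_trans B2) // leq_pmulr // expn_gt0 ltnW.
have n0 : 0 < n by rewrite /n; lia.
have n2x : n.*2 <= x by rewrite /n; lia.
have xn : x <= n.*2.+1 by rewrite /n; lia.
have le1 : count prime (iota 0 n.*2.+1) <= count prime (iota 0 x.+1).
  rewrite (_ : x.+1 = n.*2.+1 + (x - n.*2)); last by lia.
  by rewrite iotaD count_cat leq_addr.
have h1 : 2 ^ n <= x ^ (B ^ j).
  apply: leq_trans (leq_trans (bin_double_ge n) (bin_double_le n0)) _.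
  apply: leq_trans (_ : x ^ count prime (iota 0 n.*2.+1) <= _).
    by case: (count _ _) => // c; rewrite leq_exp2r.
  by apply: leq_pexp2l (ltnW x2) _; apply: leq_trans le1 (ltnW cnt).
(* Two factors come from squaring [h1]; the third covers the factor 2 lost in rounding [x./2]. *)
have h2 : 2 ^ x <= x ^ (B ^ j) * x ^ (B ^ j) * x ^ (B ^ j).
  apply: leq_trans (_ : 2 ^ (n + n).+1 <= _).
    by rewrite leq_exp2l // addnn.
  rewrite expnSr expnD; apply: leq_mul; first exact: leq_mul.
  apply: (leq_trans x2); rewrite -[X in X <= _]expn1; apply: leq_pexp2l (ltnW x2) _.
  by rewrite expn_gt0 ltnW.
move: h2; rewrite -!expnD /x -expnM.
have -> : j.+1 * (B ^ j + B ^ j + B ^ j) = 3 * j.+1 * B ^ j by lia.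
rewrite expnS !expnM.
rewrite leq_exp2r ?expn_gt0 1?(ltnW B2) // -expnM => h.
by have := leq_trans lt h; rewrite ltnn.
Qed.

(** There are at least [B ^ j.+1] primes up to [B ^ j.+2]; dropping those up to [B ^ j] leaves
    enough because [B] is at least 2. *)
Lemma card_primes_ge j : exists B0, forall B, B0 <= B ->
  B ^ j <= #|[set p : 'I_(B ^ j.+2).+1 | prime p && (B ^ j < p)]|.
Proof.
have [B0 HB] := count_prime_ge j.+1; exists (maxn B0 2) => B.
rewrite geq_max => /andP[/HB cnt B2].
have cE : count prime (iota 0 (B ^ j.+2).+1) = #|[set p : 'I_(B ^ j.+2).+1 | prime p]|.
  rewrite -sum1_count -sum1_card.
  have := @big_mkord _ 0 addn (B ^ j.+2).+1 prime (fun=> 1).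
  rewrite /index_iota subn0 => ->.
  by apply: eq_bigl => i; rewrite inE.
rewrite cE in cnt.
have split_le : #|[set p : 'I_(B ^ j.+2).+1 | prime p]| <=
   #|[set p : 'I_(B ^ j.+2).+1 | prime p && (B ^ j < p)]| + B ^ j.
  apply: leq_trans (_ : #|[set p : 'I_(B ^ j.+2).+1 | prime p && (B ^ j < p)]
     :|: [set p : 'I_(B ^ j.+2).+1 | prime p && (p <= B ^ j)]| <= _).
    apply: subset_leq_card; apply/subsetP => p; rewrite !inE => ->.
    by rewrite ltnNge; case: leqP.
  apply: leq_trans (leq_card_setU _ _) _; rewrite leq_add2l.
  rewrite cardE -(size_map val) -[X in _ <= X](size_iota 1); apply: uniq_leq_size.
    by rewrite map_inj_uniq ?enum_uniq //; apply: val_inj.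
  move=> _ /mapP[p + ->]; rewrite mem_enum inE mem_iota add1n ltnS => /andP[pp ->].
  by rewrite prime_gt0.
have : B ^ j + B ^ j <= B ^ j.+1 by rewrite addnn -mul2n expnS leq_mul2r B2 orbT.
by move: cnt split_le; lia.
Qed.

(** * Solutions of n^2 = m^g modulo t^2 *)

(* The class of [a] is the parity of its discrete logarithm. *)
Lemma square_class t : prime t -> exists c : nat -> bool, forall a b,
  ~~ (t %| a) -> ~~ (t %| b) -> c a = c b -> exists x, x ^ 2 = a * b %[mod t].
Proof.
move=> pt.
have /cyclicP[w wE] := field_unit_group_cyclic [set: {unit 'F_t}]%G.
(* A discrete logarithm to base [w]; the default 0 is returned only when [t] divides [a]. *)
pose lg (a : nat) := odflt ord0 [pick i : 'I_(#[w]%g).+1 | (a%:R == val w ^+ i :> 'F_t)%R].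
have lgP a : ~~ (t %| a) -> (a%:R = val w ^+ lg a :> 'F_t)%R.
  move=> ta; have a0 : (a%:R != 0 :> 'F_t)%R.
    by rewrite -(GRing.dvdn_pcharf (pchar_Fp pt)).
  have ua : (a%:R : 'F_t)%R \is a GRing.unit by rewrite GRing.unitfE.
  have : (FinRing.Unit ua) \in <[w]>%g by rewrite -wE inE.
  move=> /cyclePmin[i iw iE].
  rewrite /lg; case: pickP => [j /eqP //|/(_ (Ordinal (ltnW iw : i < (#[w]%g).+1)))].
  by move/eqP; case; rewrite /= -FinRing.val_unitX -iE.
exists (fun a => odd (lg a)) => a b ta tb ab.
pose h := (lg a + lg b)./2.
have hE : lg a + lg b = h * 2.
  by rewrite muln2 /h; have := odd_double_half (lg a + lg b); rewrite oddD ab addbb add0n.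
exists (val (val w ^+ h)%R : nat); apply/eqP.
have : ((val (val w ^+ h)%R : nat)%:R ^+ 2 = (a * b)%:R :> 'F_t)%R.
  rewrite natr_Zp GRing.natrM (lgP _ ta) (lgP _ tb) -GRing.exprD hE GRing.exprM //.
rewrite -GRing.natrX => /(congr1 val); rewrite /= !val_Fp_nat // => ->.
by [].
Qed.

(** One Newton step of Hensel's lemma, possible because [2 * x] is invertible modulo [t]. *)
Lemma sqrt_lift t c x : prime t -> odd t -> ~~ (t %| c) -> x ^ 2 = c %[mod t] ->
  exists y, y ^ 2 = c %[mod t ^ 2].
Proof.
move=> pt ot tc xc; have t0 := prime_gt0 pt.
(* The shift keeps the residue modulo [t] and ensures [c <= x0 ^ 2], so that [x0 ^ 2 - c] is a true
   difference. *)
pose x0 := x + t * c.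
have le : c <= x0 ^ 2.
  rewrite /x0; case: (c) => // c'; rewrite -mulnn; nia.
have x0c : x0 ^ 2 = c %[mod t].
  by rewrite -xc /x0 -modnXm [x + _]addnC mulnC modnMDl modnXm.
have /dvdnP[e eE] : t %| x0 ^ 2 - c by rewrite -eqn_mod_dvd // x0c.
have cop : coprime (2 * x0) t.
  rewrite coprime_sym prime_coprime // Euclid_dvdM //; apply/norP; split.
    by rewrite dvdn_prime2 //; apply/eqP => t2; rewrite t2 in ot.
  apply: contra tc => tx.
  have := dvdn_exp (isT : 0 < 2) tx; rewrite /dvdn x0c; exact.
have x00 : 0 < 2 * x0 by case: (2 * x0) cop => //; rewrite /coprime gcd0n => /eqP t1; rewrite t1 in pt.
have [u v uv _] := egcdnP t x00; rewrite (eqP cop) in uv.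
(* Here [u] inverts [2 * x0] modulo [t], and [t.-1] stands for [- 1]. *)
pose k := u * e * t.-1.
exists (x0 + t * k); apply/eqP.
have -> : (x0 + t * k) ^ 2 = (v * e * t.-1 + e + k ^ 2) * t ^ 2 + c.
  have xE : x0 ^ 2 = e * t + c by rewrite -eE subnK.
  have -> : (x0 + t * k) ^ 2 = x0 ^ 2 + (u * (2 * x0)) * (t * e * t.-1) + k ^ 2 * t ^ 2.
    by rewrite /k; lia.
  rewrite xE uv; case: (t) t0 => // t' _ /=; rewrite -!mulnn; lia.
by rewrite modnMDl.
Qed.

(** Among three consecutive terms of the progression each of [a], [b] divides at most one, so some
    term is coprime to both. There is room for [I] such blocks below [N]. *)
Lemma card_progression_coprime (q a b c N I : nat) : prime a -> prime b ->
  2 < a -> 2 < b -> coprime a q -> coprime b q -> 0 < q -> 3 * q * I <= N ->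
  I <= #|[set n : 'I_N | (n == c %[mod q]) && coprime (a * b) n]|.
Proof.
move=> pa pb a2 b2 aq bq q0 IN.
pose nn i e := c %% q + q * (3 * i + e).
have nlt i e : i < I -> e < 3 -> nn i e < N.
  move=> iI e3; apply: leq_trans IN; rewrite /nn; have := ltn_pmod c q0; nia.
have nmod i e : nn i e = c %[mod q].
  by rewrite /nn addnC mulnC modnMDl modn_mod.
have once p i e e' : prime p -> 2 < p -> coprime p q -> e < e' -> e' < 3 ->
    ~~ ((p %| nn i e) && (p %| nn i e')).
  move=> pp p2 pq ee e3; apply/negP => /andP[h1 h2].
  have : p %| nn i e' - nn i e by rewrite dvdn_sub.
  have -> : nn i e' - nn i e = q * (e' - e) by rewrite /nn; nia.
  rewrite Gauss_dvdr // => /dvdn_leq; lia.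
have good i : exists2 e, e < 3 & coprime (a * b) (nn i e).
  have H e : coprime (a * b) (nn i e) = ~~ (a %| nn i e) && ~~ (b %| nn i e).
    by rewrite coprimeMl !prime_coprime.
  have := once a i 0 1 pa a2 aq isT isT; have := once a i 0 2 pa a2 aq isT isT.
  have := once a i 1 2 pa a2 aq isT isT; have := once b i 0 1 pb b2 bq isT isT.
  have := once b i 0 2 pb b2 bq isT isT; have := once b i 1 2 pb b2 bq isT isT.
  move=> h1 h2 h3 h4 h5 h6.
  have [g|g0] := boolP (coprime (a * b) (nn i 0)); first by exists 0.
  have [g|g1] := boolP (coprime (a * b) (nn i 1)); first by exists 1.
  exists 2 => //; move: h1 h2 h3 h4 h5 h6 g0 g1; rewrite !H.
  move: (a %| nn i 0) (a %| nn i 1) (a %| nn i 2) => x0 x1 x2.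
  by move: (b %| nn i 0) (b %| nn i 1) (b %| nn i 2) x0 x1 x2 => [] [] [] [] [] [].
pose e i := if coprime (a * b) (nn i 0) then 0 else if coprime (a * b) (nn i 1) then 1 else 2.
have e3 i : e i < 3 by rewrite /e; case: ifP => // _; case: ifP.
have ecop i : coprime (a * b) (nn i (e i)).
  rewrite /e; case: ifP => // h0; case: ifP => // h1.
  by case: (good i) => [[|[|[|//]]]] // _; rewrite ?h0 ?h1.
pose f (i : 'I_I) : 'I_N := Ordinal (nlt i (e i) (ltn_ord i) (e3 i)).
have finj : injective f.
  move=> i i' /(congr1 val) /= /eqP; rewrite /nn eqn_add2l eqn_pmul2l // => /eqP h.
  by apply/val_inj => /=; move: h (e3 i) (e3 i'); lia.
rewrite -[X in X <= _](card_ord I) -(card_imset predT finj).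
apply: subset_leq_card; apply/subsetP => _ /imsetP[i _ ->].
by rewrite inE /= ecop andbT; apply/eqP.
Qed.

(** * Square part and squarefree part *)

Definition sqpart z := \max_(y < z.+1 | y ^ 2 %| z) y.
Definition sfpart z := z %/ sqpart z ^ 2.

Lemma sqpart_dvd z : 0 < z -> sqpart z ^ 2 %| z.
Proof.
move=> z0; rewrite /sqpart.
have h : 0 < #|[pred y : 'I_z.+1 | y ^ 2 %| z]|.
  by apply/card_gt0P; exists (inord 1); rewrite inE inordK.
by have [i hi ->] := eq_bigmax_cond (fun y : 'I_z.+1 => y : nat) h.
Qed.

Lemma leq_sqpart y z : 0 < z -> y ^ 2 %| z -> y <= sqpart z.
Proof.
move=> z0 yz; have yle : y < z.+1.
  rewrite ltnS (leq_trans _ (dvdn_leq z0 yz)) // -mulnn.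
  by case: (y) => // y'; rewrite leq_pmulr.
exact: (@leq_bigmax_cond _ (fun y : 'I_z.+1 => y ^ 2 %| z) (fun y => y : nat) (Ordinal yle)).
Qed.

Lemma sqpart_gt0 z : 0 < z -> 0 < sqpart z.
Proof. by move=> z0; apply: leq_sqpart. Qed.

Lemma sqpartE z : 0 < z -> z = sqpart z ^ 2 * sfpart z.
Proof. by move=> z0; rewrite mulnC divnK // sqpart_dvd. Qed.

Lemma sfpart_gt0 z : 0 < z -> 0 < sfpart z.
Proof. by move=> z0; move: (z0); rewrite {1}(sqpartE z0) muln_gt0 => /andP[]. Qed.

(** A square [k ^ 2] dividing it could be moved into the square part, whose maximality forces
    [k = 1]. *)
Lemma sfpart_squarefree z : 0 < z -> squarefree (sfpart z).
Proof.
move=> z0 k kd; have s0 := sqpart_gt0 z0.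
have k0 : 0 < k.
  by case: k kd => //; rewrite dvd0n => /eqP e; have := sfpart_gt0 z0; rewrite e.
have : (sqpart z * k) ^ 2 %| z.
  by rewrite expnMn {2}(sqpartE z0) dvdn_mul.
move=> /(leq_sqpart z0); nia.
Qed.

Lemma prime_dvd_sqpart t z : prime t -> 0 < z -> t ^ 2 %| z -> t %| sqpart z.
Proof.
move=> pt z0 tz; apply/negPn/negP => ts.
have : t ^ 2 %| sfpart z.
  rewrite -(@Gauss_dvdr _ (sqpart z ^ 2)) -?sqpartE //.
  by rewrite coprimeXl // coprimeXr // prime_coprime.
by move=> /(sfpart_squarefree z0) t1; rewrite t1 in pt.
Qed.

(** A common prime [p] of [P] and [sqpart z] would give [p ^ 2 %| z]; so [P] is coprime to the
    square part. *)
Lemma dvd_sfpart (P z : nat) : squarefree P -> 0 < z -> P %| z ->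
  (forall p, prime p -> p %| P -> ~~ (p ^ 2 %| z)) -> P %| sfpart z.
Proof.
move=> sqfP z0 Pz H; rewrite -(@Gauss_dvdr _ (sqpart z ^ 2)) -?sqpartE //.
rewrite coprimeXr // coprime_sym; apply/negPn/negP => ncop.
have P0 : 0 < P by rewrite (dvdn_gt0 z0).
have g1 : 1 < gcdn (sqpart z) P.
  by rewrite ltn_neqAle eq_sym ncop gcdn_gt0 P0 orbT.
have pp := pdiv_prime g1; have pd := pdiv_dvd (gcdn (sqpart z) P).
move: pd; rewrite dvdn_gcd => /andP[ps pP].
have := H _ pp pP; rewrite (dvdn_trans _ (sqpart_dvd z0)) //.
by rewrite dvdn_exp2r.
Qed.

(* With [n = a^g (1 + P)] modulo [P^2] one has [m^g - n^2 = - 2 P a^(2g)] modulo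
   [P^2], so each prime of [P] divides [m^g - n^2] exactly once. *)
Lemma dvd_sfpart_progression (P a b g n : nat) : squarefree P -> odd P -> coprime a P ->
  a = b %[mod P ^ 2] -> n = a ^ g * P.+1 %[mod P ^ 2] -> n ^ 2 < (a * b) ^ g ->
  P %| sfpart ((a * b) ^ g - n ^ 2).
Proof.
move=> sqfP oP aP ab nE nlt; set z := _ - _.
have z0 : 0 < z by rewrite subn_gt0.
have zE : z + n ^ 2 = (a * b) ^ g by rewrite subnK // ltnW.
have P0 : 0 < P by case: P oP {sqfP aP ab nE}.
have mE : (a * b) ^ g = a ^ (2 * g) %[mod P ^ 2].
  by rewrite expnM -[RHS]modnXm -mulnn -[in RHS]modnMmr ab modnMmr modnXm.
have n2E : n ^ 2 = a ^ (2 * g) * P.*2.+1 %[mod P ^ 2].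
  rewrite -modnXm nE modnXm.
  have -> : (a ^ g * P.+1) ^ 2 = a ^ (2 * g) * P ^ 2 + a ^ (2 * g) * P.*2.+1.
    by rewrite [2 * g]mulnC expnM; lia.
  by rewrite modnMDl.
have key : P ^ 2 %| z + a ^ (2 * g) * P.*2.
  have : z + a ^ (2 * g) * P.*2 + a ^ (2 * g) = 0 + a ^ (2 * g) %[mod P ^ 2].
    have -> : z + a ^ (2 * g) * P.*2 + a ^ (2 * g) = z + a ^ (2 * g) * P.*2.+1 by lia.
    by rewrite -modnDmr -n2E modnDmr zE mE add0n.
  by move=> /eqP; rewrite eqn_modDr mod0n.
apply: dvd_sfpart => //.
  have : P %| z + a ^ (2 * g) * P.*2 by apply: dvdn_trans key; rewrite -mulnn dvdn_mulr.
  by rewrite dvdn_addl // -muln2 mulnCA dvdn_mulr.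
move=> p pp pP; apply/negP => pz.
have : p ^ 2 %| z + a ^ (2 * g) * P.*2 by apply: dvdn_trans key; rewrite dvdn_exp2r.
rewrite dvdn_addr // -muln2 mulnCA Gauss_dvdl => [/sqfP p1|]; first by rewrite p1 in pp.
rewrite coprimeXl // coprimeMr coprimeXr.
  by rewrite prime_coprime // dvdn_prime2 //; apply/eqP => p2; rewrite p2 dvdn2 oP in pP.
by rewrite prime_coprime //; apply/negP => pa; move: aP; rewrite coprime_sym => /(coprime_dvdl pP);
  rewrite prime_coprime // pa.
Qed.

(** By the Chinese remainder theorem [n] may be taken as [s ^ g] modulo [t ^ 2], where
    [s ^ 2 = a * b], and as [a ^ g * P.+1] modulo [P ^ 2]. These conditions form one progression
    modulo [(t * P) ^ 2]. *)
Lemma card_progression_good (g P t a b N I : nat) :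
  squarefree P -> odd P -> prime t -> odd t -> ~~ (t %| P) ->
  prime a -> prime b -> 2 < a -> 2 < b -> coprime a P -> coprime b P ->
  ~~ (t %| a) -> ~~ (t %| b) -> a = b %[mod P ^ 2] ->
  (exists x, x ^ 2 = a * b %[mod t]) ->
  N ^ 2 <= (a * b) ^ g -> 3 * (t * P) ^ 2 * I <= N ->
  I <= #|[set n : 'I_N | [&& coprime (a * b) n,
            t ^ 2 %| (a * b) ^ g - n ^ 2 & P %| sfpart ((a * b) ^ g - n ^ 2)]]|.
Proof.
move=> sqfP oP pt ot tP pa pb a2 b2 aP bP ta tb ab [x xE] NE IE.
have tab : ~~ (t %| a * b) by rewrite Euclid_dvdM // negb_or ta.
have [s sE] := sqrt_lift pt ot tab xE.
have P0 : 0 < P by case: P oP {sqfP tP aP bP ab IE}.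
have cop : coprime (t ^ 2) (P ^ 2) by rewrite coprimeXl // coprimeXr // prime_coprime.
pose c := chinese (t ^ 2) (P ^ 2) (s ^ g) (a ^ g * P.+1).
have aq : coprime a ((t * P) ^ 2).
  by rewrite coprimeXr // coprimeMr aP andbT coprime_sym prime_coprime.
have bq : coprime b ((t * P) ^ 2).
  by rewrite coprimeXr // coprimeMr bP andbT coprime_sym prime_coprime.
have q0 : 0 < (t * P) ^ 2 by rewrite expn_gt0 muln_gt0 prime_gt0 // P0.
apply: leq_trans (card_progression_coprime c pa pb a2 b2 aq bq q0 IE) _.
apply: subset_leq_card; apply/subsetP => n; rewrite !inE => /andP[/eqP nc ->] /=.
have nlt : n ^ 2 < (a * b) ^ g by apply: leq_trans NE; rewrite ltn_exp2r.
have nt : n = s ^ g %[mod t ^ 2].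
  rewrite -(chinese_modl cop (s ^ g) (a ^ g * P.+1)) -/c.
  by rewrite -(modn_dvdm n (dvdn_mulr (P ^ 2) (dvdnn (t ^ 2)))) -expnMn nc expnMn modn_dvdm // dvdn_mulr.
have nP : n = a ^ g * P.+1 %[mod P ^ 2].
  rewrite -(chinese_modr cop (s ^ g) (a ^ g * P.+1)) -/c.
  by rewrite -(modn_dvdm n (dvdn_mull (t ^ 2) (dvdnn (P ^ 2)))) -expnMn nc expnMn modn_dvdm // dvdn_mull.
rewrite dvd_sfpart_progression // andbT -eqn_mod_dvd; last exact: ltnW.
by apply/eqP; rewrite -[RHS]modnXm nt modnXm -expnM [g * 2]mulnC expnM -[RHS]modnXm sE modnXm.
Qed.

(** * Counting square roots and representations *)

Lemma card_fibers (T L : finType) (S : {set T}) (f : T -> L) :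
  #|S| = \sum_l #|[set x in S | f x == l]|.
Proof.
rewrite -sum1_card (partition_big f predT) //=; apply: eq_bigr => l _.
by rewrite -sum1_card; apply: eq_bigl => x; rewrite inE.
Qed.

Lemma card_le_tau_mul (T : finType) (S : {set T}) (f : T -> nat) (q K : nat) : 0 < q ->
  (forall x, x \in S -> f x %| q) -> (forall e, #|[set x in S | f x == e]| <= K) ->
  #|S| <= tau q * K.
Proof.
move=> q0 fq fK.
apply: leq_trans (_ : \sum_(x in S) \sum_(e <- divisors q) (f x == e) <= _).
  rewrite -sum1_card; apply: leq_sum => x xS.
  rewrite (big_rem (f x)) /= ?eqxx // -dvdn_divisors // fq //.
rewrite exchange_big /=.
apply: leq_trans (_ : \sum_(e <- divisors q) K <= _); last first.
  by rewrite big_const_seq count_predT iter_addn_0 mulnC.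
apply: leq_sum => e _.
apply: leq_trans (fK e); rewrite -sum1_card big_mkcond /= [X in _ <= X]big_mkcond /=.
by apply: leq_sum => x _; rewrite inE; case: (x \in S) => //=; case: eqP.
Qed.

Lemma card_mod_class (L N : nat) (S : {set 'I_N}) : 0 < L ->
  (forall x y, x \in S -> y \in S -> x = y %[mod L]) -> #|S| <= (N %/ L).+1.
Proof.
move=> L0 H.
have lt (x : 'I_N) : x %/ L < (N %/ L).+1 by rewrite ltnS leq_div2r // ltnW.
pose f (x : 'I_N) := Ordinal (lt x).
rewrite -(card_ord (N %/ L).+1) -(@card_in_imset _ _ f S) ?max_card //.
move=> x y xS yS /(congr1 val) /= e; apply/val_inj => /=.
by rewrite (divn_eq x L) (divn_eq y L) e (H x y xS yS).
Qed.

Lemma eq_sqr_mod_gcd q n n0 : 0 < q -> n ^ 2 = n0 ^ 2 %[mod q] ->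
  n = n0 %[mod q %/ gcdn (n + n0) q].
Proof.
move=> q0; wlog le : n n0 / n0 <= n.
  by case: (leqP n0 n) => [h|/ltnW h] W; [exact: W|move/esym/(W _ _ h); rewrite addnC].
move=> /eqP; rewrite eqn_mod_dvd ?leq_exp2r // subn_sqr => qd.
set e := gcdn _ _; have e0 : 0 < e by rewrite gcdn_gt0 q0 orbT.
apply/eqP; rewrite eqn_mod_dvd // -(@Gauss_dvdl _ _ ((n + n0) %/ e)).
  by rewrite -(@dvdn_pmul2r e) // divnK ?dvdn_gcdr // -mulnA divnK // dvdn_gcdl.
by rewrite /coprime -(@eqn_pmul2r e) // muln_gcdl !divnK ?dvdn_gcdl ?dvdn_gcdr // mul1n gcdnC.
Qed.

(** Fix a root [n0] and sort the roots [n] by [e = gcdn (n + n0) q]. Then [n] is [- n0] modulo [e]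
    and [n0] modulo [q %/ e], hence fixed modulo their least common multiple. *)
Lemma card_sqrt_mod (q c N : nat) : 0 < q -> coprime c q ->
  #|[set n : 'I_N | n ^ 2 == c %[mod q]]| <= tau q * ((2 * N) %/ q).+1.
Proof.
move=> q0 cop; set S := [set _ | _].
have [->|[n0 n0S]] := set_0Vmem S; first by rewrite cards0.
have {n0S} n0E : n0 ^ 2 = c %[mod q] by apply/eqP; move: n0S; rewrite inE.
have n0q : coprime n0 q.
  by rewrite -(@coprime_pexpl 2) // -coprime_modl n0E coprime_modl.
apply: (card_le_tau_mul (f := fun n : 'I_N => gcdn (n + n0) q)) => // [n _|e].
  exact: dvdn_gcdr.
set S' := [set _ in S | _].
have S'P n : n \in S' -> gcdn (n + n0) q = e /\ n = n0 %[mod q %/ e].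
  rewrite !inE => /andP[/eqP nE /eqP ge]; split=> //.
  by have := eq_sqr_mod_gcd q0 (etrans nE (esym n0E)); rewrite ge.
have [->|[n1 n1S]] := set_0Vmem S'; first by rewrite cards0.
have [eE n1E] := S'P _ n1S.
have eq : e %| q by rewrite -eE dvdn_gcdr.
have e0 : 0 < e by rewrite (dvdn_gt0 q0).
have qe0 : 0 < q %/ e by rewrite divn_gt0 // dvdn_leq.
pose L := lcmn e (q %/ e).
have L0 : 0 < L by rewrite lcmn_gt0 e0.
(* The common divisor of [e] and [q %/ e] divides [2 * n0] and is coprime to [n0], so it divides
   2. *)
have qL : q <= 2 * L.
  rewrite -{1}(divnK eq) mulnC -muln_lcm_gcd mulnC leq_mul2r; apply/orP; right.
  apply: dvdn_leq => //; set de := gcdn _ _.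
  have de1 : de %| e := dvdn_gcdl _ _; have de2 : de %| q %/ e := dvdn_gcdr _ _.
  have : de %| n0 * 2.
    rewrite muln2 -addnn /dvdn -modnDml -(modn_dvdm n0 de2) -n1E modn_dvdm // modnDml.
    by apply: dvdn_trans de1 _; rewrite -eE dvdn_gcdl.
  rewrite Gauss_dvdr // coprime_sym; apply: coprime_dvdr n0q.
  exact: dvdn_trans de1 eq.
apply: leq_trans (_ : (N %/ L).+1 <= _); last first.
  by rewrite ltnS -(@divnMl 2 N L) // leq_div2l.
apply: card_mod_class => // x y xS yS; wlog le : x y xS yS / y <= x.
  by case: (leqP y x) => [h|/ltnW h] W; [exact: W|apply/esym/W].
have [xe xE] := S'P _ xS; have [ye yE] := S'P _ yS.
apply/eqP; rewrite eqn_mod_dvd // dvdn_lcm -!eqn_mod_dvd // xE yE eqxx andbT.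
rewrite -(eqn_modDr n0) /eqn; apply/eqP.
have /eqP -> : (x + n0) %% e == 0 by rewrite -/(dvdn e _) -{1}xe dvdn_gcdl.
by have /eqP -> : (y + n0) %% e == 0 by rewrite -/(dvdn e _) -{1}ye dvdn_gcdl.
Qed.

(* A coprime representation [n^2 + d y^2 = Q] is determined by the square root
   [n / y] of [- d] modulo [Q]. *)
Lemma card_representations (Q d N : nat) (S : {set 'I_N}) (y : 'I_N -> nat) :
  0 < d -> coprime d Q -> (forall n, n \in S ->
     [/\ 0 < y n, coprime n (y n) & n ^ 2 + y n ^ 2 * d = Q]) ->
  #|S| <= tau Q * 3.
Proof.
move=> d0 dQ H.
have [->|[n1 /H[y1 _ QE]]] := set_0Vmem S; first by rewrite cards0.
have Q0 : 0 < Q by rewrite -QE addn_gt0 muln_gt0 !expn_gt0 y1 d0 orbT.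
have yQ n : n \in S -> coprime (y n) Q.
  move=> nS; have [yn cop nE] := H n nS.
  rewrite -nE -(@coprime_pexpl 2) // addnC /coprime mulnC gcdnMDl.
  by rewrite -/(coprime _ _) coprime_pexpl // coprime_pexpr // coprime_sym.
pose r n := [pick x : 'I_Q | x * y n == n %[mod Q]].
have rP (n : 'I_N) : n \in S -> exists2 x : 'I_Q, r n = Some x & x * y n = n %[mod Q].
  move=> nS; rewrite /r; case: pickP => [x /eqP xE|no]; first by exists x.
  have [y0 _ _] := H n nS.
  have [u v uv _] := egcdnP Q y0; rewrite (eqP (yQ n nS)) in uv.
  have := no (Ordinal (ltn_pmod (u * n) Q0)) => /=.
  by rewrite modnMml mulnAC uv mulnDl mul1n mulnAC modnMDl eqxx.
have x0 : 'I_Q := Ordinal Q0.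
pose R n : 'I_Q := odflt x0 (r n).
have RP n : n \in S -> R n * y n = n %[mod Q].
  by move=> nS; have [x rx xE] := rP n nS; rewrite /R rx.
have Rinj : {in S &, injective R}.
  move=> n n' nS n'S RE; have := RP n nS; have := RP n' n'S; rewrite RE => e1 e2.
  have [yn cop nE] := H n nS; have [yn' cop' nE'] := H n' n'S.
  have e3 : n * y n' = n' * y n %[mod Q].
    by rewrite -modnMml -e2 modnMml -[RHS]modnMml -e1 modnMml -!mulnA [y n * _]mulnC.
  (* Both cross products lie below [Q], so their congruence is an equality, and coprimality then
     gives [n = n']. *)
  have ltQ a b : a ^ 2 < Q -> b ^ 2 <= Q -> a * b < Q.
    move=> aQ bQ; rewrite -ltn_sqr expnMn -[X in _ < X]mulnn.
    by apply: leq_ltn_trans (leq_mul (leqnn _) bQ) _; rewrite ltn_pmul2r.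
  have pos z : 0 < z -> 0 < z ^ 2 * d by move=> z0; rewrite muln_gt0 expn_gt0 z0.
  have le z : z ^ 2 <= z ^ 2 * d by rewrite leq_pmulr.
  have lt : n * y n' < Q.
    by apply: ltQ; [rewrite -nE -[X in X < _]addn0 ltn_add2l pos|rewrite -nE' (leq_trans (le _)) ?leq_addl].
  have lt' : n' * y n < Q.
    by apply: ltQ; [rewrite -nE' -[X in X < _]addn0 ltn_add2l pos|rewrite -nE (leq_trans (le _)) ?leq_addl].
  rewrite !modn_small // in e3.
  have d1 : n %| n' by rewrite -(@Gauss_dvdl _ _ (y n)) // -e3 dvdn_mulr.
  have d2 : n' %| n by rewrite -(@Gauss_dvdl _ _ (y n')) // e3 dvdn_mulr.
  by apply/val_inj/eqP; rewrite eqn_dvd d1.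
rewrite -(card_in_imset Rinj).
(* [d * Q.-1] represents [- d] modulo [Q]. The roots range below [Q] itself, whence the factor
   [(2 * Q) %/ Q + 1 = 3]. *)
apply: leq_trans (_ : #|[set x : 'I_Q | x ^ 2 == d * Q.-1 %[mod Q]]| <= _); last first.
  apply: leq_trans (card_sqrt_mod _ Q0 _) _; last by rewrite mulnK.
  by rewrite coprimeMl dQ coprime_sym coprimenP.
apply: subset_leq_card; apply/subsetP => _ /imsetP[n nS ->]; rewrite inE.
have [yn cop nE] := H n nS.
have yQ2 : coprime Q (y n ^ 2) by rewrite coprime_sym coprimeXl // yQ.
have QE' : d * Q.-1 + d = d * Q by rewrite addnC -mulnS prednK.
rewrite -(eqn_modDr d) QE' modnMl -/(dvdn _ _) -(Gauss_dvdl _ yQ2) mulnDl -expnMn.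
by rewrite /dvdn -modnDml -modnXm RP // modnXm modnDml [d * _]mulnC nE modnn.
Qed.

(** * Cauchy-Schwarz and coincidences of squarefree parts *)

Lemma sum_sqr_le (T : finType) (A : {set T}) (r : T -> nat) :
  (\sum_(u in A) r u) ^ 2 <= #|A| * \sum_(u in A) r u ^ 2.
Proof.
rewrite -(@leq_pmul2l 2) // -mulnn big_distrlr /= big_distrr /=.
apply: leq_trans (_ : \sum_(u in A) \sum_(v in A) (r u ^ 2 + r v ^ 2) <= _).
  apply: leq_sum => u _; rewrite big_distrr /=; apply: leq_sum => v _.
  exact: nat_Cauchy.
rewrite (eq_bigr (fun u => #|A| * r u ^ 2 + \sum_(v in A) r v ^ 2)); last first.
  by move=> u _; rewrite big_split /= sum_nat_const.
by rewrite big_split /= sum_nat_const -big_distrr /= mul2n addnn.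
Qed.

(** The pairs with equal image number the sum of the squared fibre sizes, to which Cauchy-Schwarz
    applies. *)
Lemma card_sqr_le_image (T U : finType) (S : {set T}) (f : T -> U) :
  #|S| ^ 2 <= #|f @: S| *
    #|[set p : T * T | [&& p.1 \in S, p.2 \in S & f p.1 == f p.2]]|.
Proof.
pose r u := #|[set x in S | f x == u]|.
have r0 u : u \notin f @: S -> r u = 0.
  move=> uS; apply/eqP; rewrite cards_eq0; apply/eqP/setP => x; rewrite !inE.
  by apply/negP => /andP[xS /eqP e]; move: uS; rewrite -e imset_f.
have SE : #|S| = \sum_(u in f @: S) r u.
  rewrite (card_fibers S f) [RHS]big_mkcond /=; apply: eq_bigr => u _.
  by case: ifPn => // /r0.
rewrite {1}SE; apply: leq_trans (sum_sqr_le _ _) _; rewrite leq_mul2l; apply/orP; right.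
set P := [set p : T * T | _].
rewrite (card_fibers P (fun p => f p.1)) [X in X <= _]big_mkcond /=.
apply: leq_sum => u _; case: ifP => // _; rewrite -mulnn /r -cardsX.
apply: subset_leq_card; apply/subsetP => -[x x']; rewrite !inE /=.
by move=> /andP[/andP[-> /eqP->] /andP[-> /eqP->]]; rewrite !eqxx.
Qed.

Lemma eq_of_add_sub_sqr u v u' v' : u + v = u' + v' -> 0 < u + v ->
  u ^ 2 + v' ^ 2 = u' ^ 2 + v ^ 2 -> u = u'.
Proof.
move=> s s0 h.
have e1 : 2 * (u * (u + v)) + v ^ 2 = (u + v) ^ 2 + u ^ 2 by lia.
have e2 : 2 * (u' * (u' + v')) + v' ^ 2 = (u' + v') ^ 2 + u' ^ 2 by lia.
apply/eqP; rewrite -(eqn_pmul2r s0); apply/eqP; rewrite {2}s.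
rewrite -s in e2; rewrite -s; move: (u * _) (u' * _) e1 e2 => x y; lia.
Qed.

Definition absdiff a b := (a - b) + (b - a).

(* [(y2 n1 + y1 n2) (y2 n1 - y1 n2) = y2^2 m1^g - y1^2 m2^g], which vanishes only
   when both representations coincide. *)
Lemma card_common_part (g m1 m2 y1 y2 N : nat) (S : {set 'I_N * 'I_N}) :
  0 < g -> 0 < m1 -> 0 < y1 -> 0 < y2 -> coprime m1 y1 -> coprime m2 y2 ->
  (forall p, p \in S -> exists d,
     [/\ m1 ^ g = p.1 ^ 2 + y1 ^ 2 * d, m2 ^ g = p.2 ^ 2 + y2 ^ 2 * d &
         ~ [/\ m1 = m2, y1 = y2 & p.1 = p.2]]) ->
  #|S| <= tau (absdiff (y2 ^ 2 * m1 ^ g) (y1 ^ 2 * m2 ^ g)).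
Proof.
move=> g0 m10 y10 y20 c1 c2 H; set D := absdiff _ _.
have [->|[p0 p0S]] := set_0Vmem S; first by rewrite cards0.
have D0 : 0 < D.
  have [d [e1 e2 ne]] := H p0 p0S; rewrite lt0n; apply/eqP => D0; apply: ne.
  have eq : y2 ^ 2 * m1 ^ g = y1 ^ 2 * m2 ^ g by move: D0; rewrite /D /absdiff; lia.
  (* As [m1] is coprime to [y1] and [m2] to [y2], equality of the two terms makes [m1 ^ g] and
     [m2 ^ g] divide each other. *)
  have m12 : m1 = m2.
    apply/eqP; rewrite -(eqn_exp2r _ _ g0) eqn_dvd.
    rewrite -(@Gauss_dvdr (m1 ^ g) (y1 ^ 2)); last by rewrite coprimeXl // coprimeXr.
    rewrite -eq dvdn_mull //= -(@Gauss_dvdr (m2 ^ g) (y2 ^ 2)); last by rewrite coprimeXl // coprimeXr.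
    by rewrite eq dvdn_mull.
  have y12 : y1 = y2.
    apply/esym/eqP; rewrite -(@eqn_exp2r _ _ 2) // -(@eqn_pmul2r (m1 ^ g)) ?expn_gt0 ?m10 //.
    by rewrite eq m12.
  split=> //; apply/val_inj/eqP; rewrite -(@eqn_exp2r _ _ 2) //.
  by rewrite -(eqn_add2r (y1 ^ 2 * d)) -e1 m12 e2 y12.
(* The sum factor is a divisor of [D]. It determines the difference factor, since their product is
   fixed, and hence the pair. *)
rewrite cardE; apply: (size_le_tau (f := fun p : 'I_N * 'I_N => y2 * p.1 + y1 * p.2)) => //.
- exact: enum_uniq.
- move=> p p'; rewrite !mem_enum => pS p'S.
  have [d [e1 e2 _]] := H p pS; have [d' [e1' e2' _]] := H p' p'S.
  have : y2 ^ 2 * p.1 ^ 2 + y1 ^ 2 * m2 ^ g = y2 ^ 2 * m1 ^ g + y1 ^ 2 * p.2 ^ 2.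
    by rewrite e1 e2 !mulnDr addnA [RHS]addnAC [y2 ^ 2 * (_ * d)]mulnCA.
  have : y2 ^ 2 * p'.1 ^ 2 + y1 ^ 2 * m2 ^ g = y2 ^ 2 * m1 ^ g + y1 ^ 2 * p'.2 ^ 2.
    by rewrite e1' e2' !mulnDr addnA [RHS]addnAC [y2 ^ 2 * (_ * d')]mulnCA.
  move: D0; rewrite /D /absdiff -!expnMn.
  move: (y2 ^ 2 * m1 ^ g) (y1 ^ 2 * m2 ^ g) => X Z D0.
  move E1 : (y2 * p.1) => u; move E2 : (y1 * p.2) => v.
  move E1' : (y2 * p'.1) => u'; move E2' : (y1 * p'.2) => v' h' h s.
  have uu : u = u'.
    apply: (eq_of_add_sub_sqr s); last by clear -h h'; lia.
    by clear -h D0; case: u v h => [|//] [|//]; rewrite exp0n //; lia.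
  have vv : v = v' by clear -s uu; lia.
  rewrite [p]surjective_pairing [p']surjective_pairing; congr (_, _); apply/val_inj/eqP.
    by rewrite -(eqn_pmul2l y20) E1 E1' uu.
  by rewrite -(eqn_pmul2l y10) E2 E2' vv.
- move=> p; rewrite mem_enum => pS; have [d [e1 e2 _]] := H p pS.
  rewrite /D /absdiff e1 e2 !mulnDr [y2 ^ 2 * (_ * _)]mulnCA !subnDr -!expnMn !subn_sqr.
  by rewrite [y1 * _ + y2 * _]addnC dvdn_add // dvdn_mull.
Qed.

(** * Many pairs (m, n) *)

Lemma card_pigeonhole (T L : finType) (S : {set T}) (f : T -> L) : 0 < #|L| ->
  exists l, #|S| <= #|L| * #|[set x in S | f x == l]|.
Proof.
move=> L0; have [l lE] := bigop.eq_bigmax (fun l => #|[set x in S | f x == l]|) L0.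
exists l; rewrite (card_fibers S f) -sum_nat_const; apply: leq_sum => i _.
by rewrite -lE; apply: (leq_bigmax i).
Qed.

(** The prime [t] survives only through [B ^ th < sqpart _]. Oddness of [m] later makes it coprime
    to [2 n]. *)
Definition cand g P al th B m n :=
  [&& B ^ (2 * al) < m, m <= B ^ (2 * al + 4), odd m, coprime m n,
      B ^ th < sqpart (m ^ g - n ^ 2) & P %| sfpart (m ^ g - n ^ 2)].

Definition cand_set g P al th nu B :=
  [set x : 'I_(B ^ (2 * al + 4)).+1 * 'I_(B ^ nu) | cand g P al th B x.1 x.2].

(** Taking [nu] one below [g * al] leaves a gap of at least [B ^ (2 * nu)], which later bounds the
    squarefree part from below. *)
Lemma sqr_lt_cand g al nu B m n : 0 < g -> nu.+1 = g * al -> B ^ (2 * al) < m -> n < B ^ nu ->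
  1 < B -> n ^ 2 + B ^ (2 * nu) < m ^ g.
Proof.
move=> g0 nuE mB nB B1.
have h : B ^ (2 * nu.+1) < m ^ g by rewrite nuE mulnCA mulnC expnM ltn_exp2r.
apply: leq_ltn_trans h; apply: leq_trans (_ : 2 * B ^ (2 * nu) <= _).
  by rewrite [X in _ <= X]mul2n -addnn leq_add2r [2 * nu]mulnC expnM leq_exp2r // ltnW.
rewrite [2 * nu.+1]mulnS expnD leq_mul2r; apply/orP; right.
by apply: (leq_trans B1); rewrite -mulnn leq_pmulr // ltnW.
Qed.

Section LowerBound.
Variables (g P al th nu B : nat).
Hypotheses (g_odd : odd g) (P_sqf : squarefree P) (P_odd : odd P).
Hypotheses (al_gt0 : 0 < al) (th_gt0 : 0 < th) (nuE : nu.+1 = g * al).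
Hypotheses (th_nu : 2 * th + 5 <= nu) (B_gt : 4 * P ^ 2 < B).
Hypothesis B_al : B ^ al <= #|[set p : 'I_(B ^ al.+2).+1 | prime p && (B ^ al < p)]|.
Hypothesis B_th : B ^ th <= #|[set p : 'I_(B ^ th.+2).+1 | prime p && (B ^ th < p)]|.
Hypothesis B_tau : forall n, 0 < n -> n <= B ^ ((2 * al + 4) * g) -> tau n <= B.

Let P_gt0 : 0 < P. Proof. by case: P P_odd. Qed.
Let P2_gt0 : 0 < P ^ 2. Proof. by rewrite expn_gt0 P_gt0. Qed.
Let B_gt4 : 4 < B. Proof. by apply: leq_ltn_trans B_gt; rewrite leq_pmulr. Qed.
Let B_gt0 : 0 < B. Proof. exact: leq_trans B_gt4. Qed.
Let P_ltB : P < B.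
Proof. by apply: leq_ltn_trans B_gt; rewrite -mulnn mulnA leq_pmull // muln_gt0 P_gt0. Qed.
Let g_gt0 : 0 < g. Proof. by case: g g_odd. Qed.

Let big_prime e p : 0 < e -> prime p -> B ^ e < p -> [/\ odd p, 2 < p & coprime p P].
Proof.
move=> e0 pp pB; have Bp : B < p by apply: leq_ltn_trans pB; rewrite -[X in X <= _]expn1 leq_pexp2l.
have p2 : 2 < p by apply: ltn_trans Bp; apply: leq_trans B_gt4.
split=> //; first by case/even_prime: pp => // p2'; rewrite p2' in p2.
rewrite prime_coprime //; apply/negP => /dvdn_leq -/(_ P_gt0).
by rewrite leqNgt (ltn_trans P_ltB).
Qed.

Local Notation TT := 'I_(B ^ th.+2).+1.
Local Notation AA := 'I_(B ^ al.+2).+1.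
Local Notation NN := 'I_(B ^ nu).

Let quad := [set x : (TT * (AA * AA)) * NN |
  [&& prime x.1.1, prime x.1.2.1, prime x.1.2.2,
      x.1.1 ^ 2 %| (x.1.2.1 * x.1.2.2) ^ g - x.2 ^ 2 &
      cand g P al th B (x.1.2.1 * x.1.2.2) x.2]].

(** Given [m] and [n], the prime [t] divides [m ^ g - n ^ 2], [a] divides [m], and [b] is the
    cofactor. Each divisor count is at most [B]. *)
Let card_quad_le : #|quad| <= #|cand_set g P al th nu B| * (B * B).
Proof.
pose h (x : (TT * (AA * AA)) * NN) : 'I_(B ^ (2 * al + 4)).+1 * NN :=
  (inord (x.1.2.1 * x.1.2.2), x.2).
rewrite (card_fibers quad h) -sum_nat_const [X in _ <= X]big_mkcond /=.
apply: leq_sum => -[m n] _; set S := [set x in quad | _].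
have SP x : x \in S -> [/\ prime x.1.1, x.1.1 ^ 2 %| m ^ g - n ^ 2,
    x.1.2.1 * x.1.2.2 = m, x.2 = n & cand g P al th B m n].
  rewrite !inE => /andP[/and5P[pt _ _ td c]] /eqP[mE nE].
  have mE' : x.1.2.1 * x.1.2.2 = m.
    by rewrite -mE inordK // ltnS; case/and5P: c.
  by move: td c; rewrite mE' nE; split.
have [->|[x0 x0S]] := set_0Vmem S; first by rewrite cards0.
have [_ _ _ _ c] := SP _ x0S; rewrite inE /= c.
have /and5P[mlt mle _ _ _] := c.
have lt := sqr_lt_cand g_gt0 nuE mlt (ltn_ord n) (leq_trans (isT : 1 < 4) (ltnW B_gt4)).
have m0 : 0 < m by apply: leq_ltn_trans mlt.
have z0 : 0 < m ^ g - n ^ 2 by rewrite subn_gt0 (leq_ltn_trans _ lt) ?leq_addr.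
have mg : m ^ g <= B ^ ((2 * al + 4) * g) by rewrite expnM leq_exp2r.
apply: leq_trans (_ : tau (m ^ g - n ^ 2) * (tau m * 1) <= _); last first.
  rewrite muln1 leq_mul // B_tau //; first exact: leq_trans (leq_subr _ _) mg.
  by apply: leq_trans mg; rewrite -[X in X <= _]expn1 leq_pexp2l.
apply: (card_le_tau_mul (f := fun x : (TT * (AA * AA)) * NN => x.1.1 : nat)) => // [x /SP[pt td _ _ _]|t].
  by apply: dvdn_trans td; rewrite -mulnn dvdn_mulr.
apply: (card_le_tau_mul (f := fun x : (TT * (AA * AA)) * NN => x.1.2.1 : nat)) => // [x|a].
  by rewrite inE => /andP[/SP[_ _ <- _ _] _]; rewrite dvdn_mulr.
apply/card_le1_eqP => x y; rewrite inE => /andP[]; rewrite inE => /andP[xS /eqP xt] /eqP xa.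
rewrite inE => /andP[]; rewrite inE => /andP[yS /eqP yt] /eqP ya.
have [_ _ xm xn _] := SP _ xS; have [_ _ ym yn _] := SP _ yS.
case: x y xt xa yt ya xm ym xn yn {xS yS} => [[t1 [a1 b1]] n1] [[t2 [a2 b2]] n2] /=.
move=> t1E a1E t2E a2E m1 m2 -> ->.
have -> : t1 = t2 by apply/val_inj; rewrite /= t1E.
have aE : a1 = a2 by apply/val_inj; rewrite /= a1E.
have -> : b1 = b2; last by rewrite aE.
apply/val_inj/eqP => /=; rewrite -(@eqn_pmul2l a1) ?m1 ?aE ?m2 //.
by move: m0; rewrite -m2 muln_gt0 => /andP[].
Qed.

(** Pigeonhole over [2 * P ^ 2] labels, the square class modulo [t] and the residue modulo [P ^ 2];
    as [4 * P ^ 2 < B], this costs at most one power of [B]. *)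
Let card_class_ge (t : TT) : prime t -> B ^ th < t -> exists C : {set AA},
  B ^ (al - 1) <= #|C| /\ forall a b, a \in C -> b \in C ->
    [/\ prime a, B ^ al < a, ~~ (t %| a), a = b %[mod P ^ 2] &
        exists x, x ^ 2 = a * b %[mod t]].
Proof.
move=> pt tB; have [c cP] := square_class pt.
(* [t] is removed so that it divides no element. If it is out of range, [inord t] is 0, which is not
   prime. *)
pose S := [set p : AA | prime p && (B ^ al < p)] :\ inord t.
pose f (a : AA) : bool * 'I_(P ^ 2) := (c a, Ordinal (ltn_pmod a P2_gt0)).
have L0 : 0 < #|{: bool * 'I_(P ^ 2)}| by rewrite card_prod card_bool card_ord muln_gt0.
have [l lE] := card_pigeonhole S f L0.
exists [set x in S | f x == l]; split.
  rewrite card_prod card_bool card_ord in lE.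
  have S_ge : B ^ al <= #|S|.+1.
    apply: leq_trans B_al _; rewrite (cardsD1 (inord t)) -/S.
    by case: (_ \in _); rewrite ?add1n ?add0n.
  have P22 : 0 < 2 * P ^ 2 by rewrite muln_gt0.
  rewrite -(leq_pmul2l P22); apply: leq_trans lE.
  rewrite -ltnS; apply: leq_trans S_ge.
  rewrite -[in X in _ < X](subnK al_gt0) expnD expn1 mulnC.
  apply: leq_trans (_ : B ^ (al - 1) * (4 * P ^ 2) <= _); last by rewrite leq_mul2l (ltnW B_gt) orbT.
  by rewrite ltn_pmul2l ?expn_gt0 ?B_gt0 // ltn_pmul2r.
have CP a : a \in [set x in S | f x == l] -> [/\ prime a, B ^ al < a, ~~ (t %| a) & f a = l].
  rewrite !inE => /andP[/andP[ne /andP[pa aB]] /eqP fa]; split=> //.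
  apply: contra ne; rewrite dvdn_prime2 // => /eqP ta; apply/eqP/val_inj.
  by rewrite /= ta inord_val.
move=> a b /CP[pa aB ta fa] /CP[pb bB tb fb].
have [ca ma] : c a = c b /\ a = b %[mod P ^ 2].
  by have := etrans fa (esym fb); rewrite /f => -[-> ->].
by split=> //; apply: cP.
Qed.

(** The factors count [t], then [a] and [b] in one class of [card_class_ge], then [n]. The loss
    [2 * th + 5] covers [3 * (t * P) ^ 2], as [t <= B ^ th.+2] and [3 * P ^ 2 < B]. *)
Let card_quad_ge : B ^ th * (B ^ (al - 1) * B ^ (al - 1) * B ^ (nu - (2 * th + 5))) <= #|quad|.
Proof.
rewrite (card_fibers quad (fun x => x.1.1)).
apply: leq_trans (_ : \sum_(t in [set p : TT | prime p && (B ^ th < p)])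
   (B ^ (al - 1) * B ^ (al - 1) * B ^ (nu - (2 * th + 5))) <= _).
  by rewrite sum_nat_const leq_mul2r B_th orbT.
rewrite big_mkcond /=; apply: leq_sum => t _; case: ifP => //; rewrite inE => /andP[pt tB].
have [C [C_ge CP]] := card_class_ge pt tB.
set Qt := [set x in quad | _].
rewrite (card_fibers Qt (fun x => x.1.2)).
apply: leq_trans (_ : \sum_(p in setX C C) B ^ (nu - (2 * th + 5)) <= _).
  by rewrite sum_nat_const cardsX leq_mul2r leq_mul ?orbT.
rewrite big_mkcond /=; apply: leq_sum => -[a b] _; case: ifP => //.
rewrite inE /= => /andP[aC bC].
have [pa aB ta ab sq] := CP _ _ aC bC; have [pb bB tb _ _] := CP _ _ bC bC.
have [oa a2 aP] := big_prime al_gt0 pa aB; have [ob b2 bP] := big_prime al_gt0 pb bB.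
have [ot t2 tP] := big_prime th_gt0 pt tB.
have tP' : ~~ (t %| P) by rewrite -prime_coprime.
have mlt : B ^ (2 * al) < a * b.
  by rewrite mul2n -addnn expnD ltn_mul.
have NE : (B ^ nu) ^ 2 <= (a * b) ^ g.
  apply: leq_trans (_ : (B ^ (2 * al)) ^ g <= _); last by rewrite leq_exp2r // ltnW.
  by rewrite -!expnM leq_pexp2l // -mulnA [al * g]mulnC -nuE mulnC leq_mul2l leqnSn.
have IE : 3 * (t * P) ^ 2 * B ^ (nu - (2 * th + 5)) <= B ^ nu.
  rewrite -[in X in _ <= X](subnK th_nu) expnD [X in _ <= X]mulnC leq_mul2r; apply/orP; right.
  have -> : B ^ (2 * th + 5) = B * (B ^ th.+2) ^ 2.
    by rewrite -expnM -expnS; congr (_ ^ _); clear; lia.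
  rewrite expnMn mulnCA mulnC leq_mul //; last by rewrite leq_exp2r // -ltnS.
  by apply: leq_trans (ltnW B_gt); rewrite leq_mul2r orbT.
have := card_progression_good P_sqf P_odd pt ot tP' pa pb a2 b2 aP bP ta tb ab sq NE IE.
move=> /leq_trans; apply.
have finj : injective (fun n : NN => ((t, (a, b)), n)) by move=> n n' [].
rewrite -(card_imset _ finj); apply: subset_leq_card; apply/subsetP => _ /imsetP[n nP ->].
move: nP; rewrite !inE /= pt pa pb !eqxx !andbT => /and3P[cop td Pd]; rewrite td /cand mlt cop Pd.
have lt := sqr_lt_cand g_gt0 nuE mlt (ltn_ord n) (leq_trans (isT : 1 < 4) (ltnW B_gt4)).
have z0 : 0 < (a * b) ^ g - n ^ 2 by rewrite subn_gt0 (leq_ltn_trans _ lt) ?leq_addr.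
rewrite oddM oa ob /= ?andbT; apply/andP; split.
  have -> : 2 * al + 4 = al.+2 + al.+2 by clear; lia.
  by rewrite expnD leq_mul // -ltnS.
apply: leq_trans tB _; apply: dvdn_leq; first exact: sqpart_gt0.
exact: prime_dvd_sqpart.
Qed.

Lemma card_cand_ge : B ^ (2 * al + nu - (th + 9)) <= #|cand_set g P al th nu B|.
Proof.
rewrite -(@leq_pmul2r (B * B)) ?muln_gt0 ?B_gt0 //.
apply: leq_trans card_quad_le; apply: leq_trans card_quad_ge.
rewrite -!expnD mulnn -expnD leq_pexp2l //; lia.
Qed.

End LowerBound.

(** * Pairs with a large square divisor *)

(** The terms [C %/ y ^ 2] telescope against [C %/ y.-1 - C %/ y], and the added ones sum to at most
    [Y1]. *)
Lemma sum_div_sqr_le C Y0 Y1 : 0 < Y0 ->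
  \sum_(y < Y1.+1 | Y0 < y) (C %/ y ^ 2).+1 <= C %/ Y0 + Y1.
Proof.
move=> Y00; suff : \sum_(y < Y1.+1 | Y0 < y) (C %/ y ^ 2).+1 + C %/ maxn Y0 Y1 <= C %/ Y0 + Y1.
  by apply: leq_trans; rewrite leq_addr.
elim: Y1 => [|Y1 IH].
  by rewrite big1 ?maxn0 ?addn0 // => -[[|//] ?].
rewrite big_mkcond big_ord_recr /= -big_mkcond /=; case: ltnP => [lt|le].
  have m1 : maxn Y0 Y1 = Y1 by apply/maxn_idPr; rewrite -ltnS.
  rewrite m1 in IH; rewrite addnS addSn -addnA.
  rewrite [X in _ < X]addnS ltnS; apply: leq_trans IH; rewrite leq_add2l.
  have Y10 : 0 < Y1 by apply: leq_trans Y00 _; rewrite -ltnS.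
  rewrite leq_divRL // -mulnn divnMA.
  have := leq_divM (C %/ Y1.+1) Y1.+1; have := leq_divM C Y1.+1.
  move: (C %/ Y1.+1) => v; move: (v %/ Y1.+1) => u; nia.
rewrite addn0; have m1 : maxn Y0 Y1 = Y0 by apply/maxn_idPl; apply: ltnW.
by rewrite addnS; rewrite m1 in IH; apply: leqW.
Qed.

Lemma coprime_of_add a b c : a = b + c -> coprime a b -> coprime a c /\ coprime b c.
Proof.
move=> ->; rewrite /coprime gcdnC gcdnDl => bc; split=> //.
by rewrite gcdnC addnC gcdnDl gcdnC.
Qed.

Section UpperBound.
Variables (g P al th nu B : nat).
Hypotheses (g_gt0 : 0 < g) (nuE : nu.+1 = g * al) (B_gt1 : 1 < B).

Local Notation X := ('I_(B ^ (2 * al + 4)).+1 * 'I_(B ^ nu))%type.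
Local Notation S := (cand_set g P al th nu B).
Local Notation z x := (x.1 ^ g - x.2 ^ 2).
Local Notation y x := (sqpart (z x)).
Local Notation d x := (sfpart (z x)).

Lemma candP (x : X) : x \in S -> [/\ B ^ (2 * nu) < z x, z x <= B ^ ((2 * al + 4) * g),
   x.1 ^ g = x.2 ^ 2 + z x, z x = y x ^ 2 * d x & [/\ 0 < y x, 0 < d x & 0 < x.1]] /\
   [/\ coprime x.1 (z x), coprime x.2 (z x), odd x.1, B ^ th < y x & P %| d x].
Proof.
rewrite inE => /and5P[mlt mle om cop /andP[yB Pd]].
have lt := sqr_lt_cand g_gt0 nuE mlt (ltn_ord x.2) B_gt1.
have lt1 : B ^ (2 * nu) < z x by rewrite ltn_subRL.
have z0 : 0 < z x by apply: leq_ltn_trans lt1.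
have le : x.2 ^ 2 <= x.1 ^ g by apply: leq_trans (ltnW lt); rewrite leq_addr.
have E : x.1 ^ g = x.2 ^ 2 + z x by rewrite subnKC.
have cop2 : coprime (x.1 ^ g) (x.2 ^ 2) by rewrite coprimeXl // coprimeXr.
split; split=> //.
- by apply: leq_trans (leq_subr _ _) _; rewrite expnM leq_exp2r.
- exact: sqpartE.
- by split; [exact: sqpart_gt0|exact: sfpart_gt0|exact: leq_ltn_trans mlt].
- by rewrite -(coprime_pexpl _ _ g_gt0); have [] := coprime_of_add E cop2.
- by rewrite -(@coprime_pexpl 2) //; have [] := coprime_of_add E cop2.
Qed.

Hypothesis B_tau : forall n, 0 < n -> n <= B ^ ((2 * al + 4) * g) -> tau n <= B.

(** For fixed [m] and square part [v], [n] is a square root of [m ^ g] modulo [v ^ 2]; the counts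
    are then summed over [v]. *)
Lemma card_bad_medium Y0 Y1 : 0 < Y0 -> #|[set x in S | Y0 < y x <= Y1]| <=
  (B ^ (2 * al + 4)).+1 * (B * ((2 * B ^ nu) %/ Y0 + Y1)).
Proof.
move=> Y00; set bad := [set _ in _ | _].
pose h (x : X) : 'I_(B ^ (2 * al + 4)).+1 * 'I_Y1.+1 := (x.1, inord (y x)).
rewrite (card_fibers bad h).
pose c (v : nat) := if Y0 < v then B * ((2 * B ^ nu) %/ v ^ 2).+1 else 0.
apply: leq_trans (_ : \sum_(l : 'I_(B ^ (2 * al + 4)).+1 * 'I_Y1.+1) c l.2 <= _).
  apply: leq_sum => -[m v] _ /=; set F := [set x in bad | _].
  have FP x : x \in F -> [/\ x \in S, Y0 < y x, x.1 = m & y x = v].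
    rewrite !inE => /andP[/andP[xS /andP[yl yr]] /eqP[mE /(congr1 val) vE]].
    by rewrite /= inordK // in vE; split=> //; rewrite inE.
  have [->|[x0 x0F]] := set_0Vmem F; first by rewrite cards0.
  have [x0S yl x0m x0y] := FP _ x0F.
  have [[z_gt z_le zE zyd [y0 d0 m0]] [c1 c2 _ _ _]] := candP x0S.
  rewrite /c -x0y yl.
  have yz : y x0 ^ 2 %| z x0 by rewrite {2}zyd dvdn_mulr.
  have z0 : 0 < z x0 by apply: leq_ltn_trans z_gt.
  have cop : coprime (m ^ g) (y x0 ^ 2).
    by rewrite -x0m coprimeXl //; apply: coprime_dvdr yz c1.
  have y20 : 0 < y x0 ^ 2 by rewrite expn_gt0 y0.
  apply: leq_trans (_ : tau (y x0 ^ 2) * ((2 * B ^ nu) %/ y x0 ^ 2).+1 <= _); last first.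
    rewrite leq_mul2r B_tau ?orbT //; apply: leq_trans z_le; exact: dvdn_leq.
  apply: leq_trans (card_sqrt_mod _ y20 cop).
  have sinj : {in F &, injective (fun x : X => x.2)}.
    move=> x x' /FP[_ _ xm _] /FP[_ _ xm' _] e.
    by rewrite [x]surjective_pairing [x']surjective_pairing e xm xm'.
  rewrite -(card_in_imset sinj); apply: subset_leq_card; apply/subsetP => _ /imsetP[x xF ->].
  have [xS _ xm xy] := FP _ xF; have [[_ _ zE' zyd' _] _] := candP xS.
  by rewrite inE -xm zE' zyd' [X in _ == X %% _]addnC xy -x0y [sqpart _ ^ 2 * _]mulnC modnMDl.
rewrite -(pair_bigA _ (fun (i : 'I_(B ^ (2 * al + 4)).+1) (j : 'I_Y1.+1) => c j)) /=.
rewrite sum_nat_const card_ord leq_mul2l; apply/orP; right.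
by rewrite /c -big_mkcond /= -big_distrr /= leq_mul2l sum_div_sqr_le ?orbT.
Qed.

(** A large square part leaves few values of the squarefree part [d]. For fixed [m] and [d], coprime
    representations of [m ^ g] are counted. *)
Lemma card_bad_large Y1 : 0 < Y1 -> #|[set x in S | Y1 < y x]| <=
  (B ^ (2 * al + 4)).+1 * ((B ^ ((2 * al + 4) * g)) %/ Y1 ^ 2).+1 * (B * 3).
Proof.
move=> Y10; set bad := [set _ in _ | _]; set Dm := _ %/ _.
pose h (x : X) : 'I_(B ^ (2 * al + 4)).+1 * 'I_Dm.+1 := (x.1, inord (d x)).
have dle x : x \in bad -> d x < Dm.+1.
  rewrite inE => /andP[/candP[[_ z_le _ zyd _] _] yl].
  rewrite ltnS leq_divRL ?expn_gt0 ?Y10 //; apply: leq_trans z_le.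
  by rewrite [X in _ <= X]zyd [X in _ <= X]mulnC leq_mul2l leq_exp2r // ltnW // orbT.
rewrite (card_fibers bad h).
apply: leq_trans (_ : \sum_(l : 'I_(B ^ (2 * al + 4)).+1 * 'I_Dm.+1) B * 3 <= _); last first.
  by rewrite sum_nat_const card_prod !card_ord.
apply: leq_sum => -[m e] _; set F := [set x in bad | _].
have FP x : x \in F -> [/\ x \in S, x.1 = m & d x = e].
  rewrite inE => /andP[xb /eqP[mE /(congr1 val) vE]].
  rewrite /= inordK ?dle // in vE; split=> //.
  by move: xb; rewrite inE => /andP[].
have [->|[x0 x0F]] := set_0Vmem F; first by rewrite cards0.
have [x0S x0m x0d] := FP _ x0F.
have [[z_gt z_le zE zyd [y0 d0 m0]] [c1 c2 _ _ _]] := candP x0S.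
have dz : d x0 %| z x0 by rewrite [X in _ %| X]zyd dvdn_mull.
have mle : m <= B ^ (2 * al + 4) by rewrite -ltnS.
apply: leq_trans (_ : tau (m ^ g) * 3 <= _); last first.
  rewrite leq_mul2r B_tau ?orbT // ?expn_gt0 -?x0m ?m0 // expnM leq_exp2r //.
  by rewrite x0m.
have sinj : {in F &, injective (fun x : X => x.2)}.
  move=> x x' /FP[_ xm _] /FP[_ xm' _] e'.
  by rewrite [x]surjective_pairing [x']surjective_pairing e' xm xm'.
rewrite -(card_in_imset sinj).
apply: (@card_representations _ e _ _ (fun n => sqpart (m ^ g - n ^ 2))).
- by rewrite -x0d.
- by rewrite -x0d -x0m coprime_sym coprimeXl //; apply: coprime_dvdr dz c1.
move=> _ /imsetP[x xF ->]; have [xS xm xd] := FP _ xF.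
have [[_ _ zE' zyd' [y0' _ _]] [_ c2' _ _ _]] := candP xS.
rewrite -xm -xd; split=> //; last by rewrite -zyd'.
by apply: coprime_dvdr c2'; rewrite [X in _ %| X]zyd' -mulnn -mulnA dvdn_mulr.
Qed.

End UpperBound.

(** * Pairs with the same squarefree part *)

Section Collisions.
Variables (g P al th nu B Y0 : nat).
Hypotheses (g_gt0 : 0 < g) (nuE : nu.+1 = g * al) (B_gt1 : 1 < B).
Hypothesis th_le : 2 * th <= (2 * al + 4) * g.
Hypothesis B_tau : forall n, 0 < n -> n <= Y0 ^ 2 * B ^ ((2 * al + 4) * g) -> tau n <= B.

Local Notation X := ('I_(B ^ (2 * al + 4)).+1 * 'I_(B ^ nu))%type.
Local Notation S := (cand_set g P al th nu B).
Local Notation z x := (x.1 ^ g - x.2 ^ 2).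
Local Notation y x := (sqpart (z x)).
Local Notation d x := (sfpart (z x)).
Local Notation dmax := (B ^ ((2 * al + 4) * g - 2 * th)).

Lemma sfpart_cand_le (x : X) : x \in S -> d x <= dmax.
Proof.
move=> /(candP g_gt0 nuE B_gt1)[[_ z_le _ zyd [_ d0 _]] [_ _ _ yB _]].
have B2 : 0 < B ^ (2 * th) by rewrite expn_gt0 ltnW.
have h : d x * B ^ (2 * th) <= B ^ ((2 * al + 4) * g).
  apply: leq_trans z_le; rewrite [X in _ <= X]zyd [X in _ <= X]mulnC leq_mul2l.
  by rewrite [2 * th]mulnC expnM leq_exp2r // ltnW // orbT.
by rewrite -(leq_pmul2r B2) -expnD subnK.
Qed.

Definition good_set := [set x in S | y x <= Y0].
(** On candidates [inord] does not alter the value, since [y > B ^ th] forces [d <= dmax]. *)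
Definition good_part (x : X) : 'I_dmax.+1 := inord (d x).

Lemma good_partE x : x \in good_set -> good_part x = d x :> nat.
Proof. by rewrite inE => /andP[xS _]; rewrite /good_part inordK // ltnS sfpart_cand_le. Qed.

Lemma tau0 : tau 0 = 1. Proof. by []. Qed.

(** The diagonal gives the first term. Off it, once both [m] and both [y] are fixed,
    [card_common_part] leaves at most [B] pairs. *)
Lemma card_collisions :
  #|[set p : X * X | [&& p.1 \in good_set, p.2 \in good_set & good_part p.1 == good_part p.2]]|
  <= #|good_set| + ((B ^ (2 * al + 4)).+1 * Y0.+1) ^ 2 * B.
Proof.
set C := [set p | _].
pose diag := [set p : X * X | p.1 == p.2].
rewrite -(cardsID diag C); set off := C :\: diag.
apply: leq_add.
  have finj : {in C :&: diag &, injective (fun p : X * X => p.1)}.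
    by move=> [a b] [a' b'] /setIP[_]; rewrite inE => /eqP /= -> /setIP[_]; rewrite inE => /eqP /= -> ->.
  rewrite -(card_in_imset finj); apply: subset_leq_card; apply/subsetP => _ /imsetP[p /setIP[pC _] ->].
  by move: pC; rewrite inE => /and3P[].
pose L := ('I_(B ^ (2 * al + 4)).+1 * 'I_Y0.+1)%type.
pose lab (x : X) : L := (x.1, inord (y x)).
rewrite (card_fibers off (fun p => (lab p.1, lab p.2))).
apply: leq_trans (_ : \sum_(l : L * L) B <= _); last first.
  by rewrite sum_nat_const !card_prod !card_ord mulnn.
apply: leq_sum => -[[m1 v1] [m2 v2]] _; set F := [set p in off | _].
have FP p : p \in F -> [/\ p.1 \in S, p.2 \in S, d p.1 = d p.2, p.1 <> p.2 &
     [/\ p.1.1 = m1, p.2.1 = m2, y p.1 = v1 & y p.2 = v2]].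
  rewrite inE => /andP[/setDP[pC pd]] /eqP[m1E v1E m2E v2E].
  have ne : p.1 <> p.2 by move=> e; rewrite inE e eqxx in pd.
  move: pC; rewrite inE => /and3P[g1 g2 /eqP dE].
  have {}dE : d p.1 = d p.2 by rewrite -!good_partE // dE.
  move: g1 g2; rewrite !inE => /andP[s1 y1] /andP[s2 y2].
  split; rewrite ?inE //; split=> //.
    by rewrite -[RHS](congr1 val v1E) /= inordK.
  by rewrite -[RHS](congr1 val v2E) /= inordK.
have [->|[p0 p0F]] := set_0Vmem F; first by rewrite cards0.
have [s1 s2 dE ne [m1E m2E v1E v2E]] := FP _ p0F.
have [[_ _ zE1 zyd1 [y10 d10 m10]] [c1 _ _ _ _]] := candP g_gt0 nuE B_gt1 s1.
have [[_ _ zE2 zyd2 [y20 d20 m20]] [c2 _ _ _ _]] := candP g_gt0 nuE B_gt1 s2.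
rewrite m1E in m10 c1 zE1 zyd1; rewrite m2E in m20 c2 zE2 zyd2.
pose nn (p : X * X) := (p.1.2, p.2.2).
have ninj : {in F &, injective nn}.
  move=> [[a1 b1] [a2 b2]] [[a1' b1'] [a2' b2']] /FP[_ _ _ _ /= [-> -> _ _]] /FP[_ _ _ _ /= [-> -> _ _]].
  by move=> [-> ->].
rewrite -(card_in_imset ninj).
have v10 : 0 < v1 by rewrite -v1E.
have v20 : 0 < v2 by rewrite -v2E.
have cv p : p \in F -> coprime m1 v1 /\ coprime m2 v2.
  move=> /FP[t1 t2 _ _ [m1E' m2E' v1E' v2E']].
  have [[_ _ _ q1 _] [k1 _ _ _ _]] := candP g_gt0 nuE B_gt1 t1.
  have [[_ _ _ q2 _] [k2 _ _ _ _]] := candP g_gt0 nuE B_gt1 t2.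
  split.
    by rewrite -v1E' -m1E'; apply: coprime_dvdr k1; rewrite [X in _ %| X]q1 -mulnn -mulnA dvdn_mulr.
  by rewrite -v2E' -m2E'; apply: coprime_dvdr k2; rewrite [X in _ %| X]q2 -mulnn -mulnA dvdn_mulr.
have [cv1 cv2] := cv _ p0F.
apply: leq_trans (_ : tau (absdiff (v2 ^ 2 * m1 ^ g) (v1 ^ 2 * m2 ^ g)) <= _).
  apply: card_common_part => // _ /imsetP[p pF ->].
  have [t1 t2 dE' ne' [m1E' m2E' v1E' v2E']] := FP _ pF.
  have [[_ _ w1 q1 _] _] := candP g_gt0 nuE B_gt1 t1.
  have [[_ _ w2 q2 _] _] := candP g_gt0 nuE B_gt1 t2.
  exists (d p.1); rewrite /nn /= -m1E' -m2E' -v1E' -v2E' -q1 dE' -q2; split=> //.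
  move=> [e1 _ e2]; apply: ne'.
  rewrite [p.1]surjective_pairing [p.2]surjective_pairing e2; congr (_, _).
  exact/val_inj.
have ub (v : 'I_Y0.+1) (m : 'I_(B ^ (2 * al + 4)).+1) :
    v ^ 2 * m ^ g <= Y0 ^ 2 * B ^ ((2 * al + 4) * g).
  by rewrite expnM; apply: leq_mul; rewrite leq_exp2r // -ltnS.
have [D0|D0] := posnP (absdiff (v2 ^ 2 * m1 ^ g) (v1 ^ 2 * m2 ^ g)).
  by rewrite D0 tau0 ltnW.
apply: B_tau => //; have := ub v2 m1; have := ub v1 m2; rewrite /absdiff.
move: (v2 ^ 2 * m1 ^ g) (v1 ^ 2 * m2 ^ g) (Y0 ^ 2 * _) => a b c; clear; lia.
Qed.

End Collisions.

(** If [G] dominates [B ^ pi], then [D >= G / 2], which suffices since [om <= pi]; otherwise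
    [D >= G ^ 2 / (2 * B ^ pi)]. The extra one in [pi.+1] pays for the 2. *)
Lemma card_image_ge (G D B om pi : nat) : 1 < B -> pi.+1 <= 2 * om -> om <= pi ->
  B ^ om <= G -> G ^ 2 <= D * (G + B ^ pi) -> B ^ (2 * om - pi.+1) <= D.
Proof.
move=> B1 h1 h2 h3 h4; have B0 : 0 < B := ltnW B1.
have Bp i : 0 < B ^ i by rewrite expn_gt0 B0.
have [le|/ltnW gt] := leqP (B ^ pi) G.
  have G0 : 0 < G by apply: leq_trans h3.
  have : G <= D * 2.
    rewrite -(leq_pmul2l G0) mulnn; apply: leq_trans h4 _.
    by rewrite [X in _ <= X]mulnCA leq_mul2l; apply/orP; right; lia.
  move=> GD; rewrite -(leq_pmul2r (ltn0Sn 1)); apply: leq_trans GD.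
  apply: leq_trans h3; apply: leq_trans (_ : B ^ (2 * om - pi.+1) * B <= _).
    by rewrite leq_mul2l B1 orbT.
  by rewrite -expnSr leq_pexp2l //; lia.
have : B ^ (2 * om) <= D * 2 * B ^ pi.
  apply: leq_trans (_ : G ^ 2 <= _); first by rewrite [2 * om]mulnC expnM leq_exp2r.
  by apply: leq_trans h4 _; rewrite -mulnA leq_mul2l; apply/orP; right; lia.
rewrite -{1}(subnK h1) expnD expnS mulnA leq_pmul2r // => h.
by rewrite -(leq_pmul2r (ltn0Sn 1)); apply: leq_trans h; rewrite leq_mul2l B1 orbT.
Qed.

(** * Counting the squarefree parts of good pairs *)

Section Main.
Variables (g P al th e B : nat).
(** [B ^ e] separates medium from large square parts. Since [B ^ nu] divided by [Y0] is also
    [B ^ e], the two terms of the medium bound balance. *)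
Local Notation nu := (e + th + 17).
Local Notation Y0 := (B ^ (th + 17)).
Hypotheses (g_odd : odd g) (P_sqf : squarefree P) (P_odd : odd P).
Hypotheses (al_gt0 : 0 < al) (th_gt0 : 0 < th) (e_gt0 : 0 < e) (nuE : nu.+1 = g * al).
Hypotheses (h3 : (2 * al + 4) * g <= 3 * e) (h4 : 2 * th + 31 <= 2 * e).
Hypotheses (h5 : e <= 2 * al + 2 * th + 37).
Hypotheses (B_gt : 4 * P ^ 2 < B) (B_gt64 : 64 < B).
Hypothesis B_al : B ^ al <= #|[set p : 'I_(B ^ al.+2).+1 | prime p && (B ^ al < p)]|.
Hypothesis B_th : B ^ th <= #|[set p : 'I_(B ^ th.+2).+1 | prime p && (B ^ th < p)]|.
Hypothesis B_tau : forall n, 0 < n -> n <= Y0 ^ 2 * B ^ ((2 * al + 4) * g) -> tau n <= B.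

Let B_gt0 : 0 < B. Proof. exact: leq_trans B_gt64. Qed.
Let B_gt1 : 1 < B. Proof. exact: leq_trans B_gt64. Qed.
Let Bp i : 0 < B ^ i. Proof. by rewrite expn_gt0 B_gt0. Qed.
Let g_gt0 : 0 < g. Proof. by case: g g_odd. Qed.
Let B_tau' n : 0 < n -> n <= B ^ ((2 * al + 4) * g) -> tau n <= B.
Proof. by move=> n0 nB; apply: B_tau => //; apply: leq_trans nB _; rewrite leq_pmull // expn_gt0 Bp. Qed.

Local Notation S := (cand_set g P al th nu B).
Local Notation good := (good_set g P al th nu B Y0).

Let M1_le : (B ^ (2 * al + 4)).+1 <= 2 * B ^ (2 * al + 4).
Proof. by rewrite [X in _ <= X]mul2n -addnn -addn1 leq_add2l. Qed.

Let bad_medium_le :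
  #|[set x in S | Y0 < sqpart (x.1 ^ g - x.2 ^ 2) <= B ^ e]| <= B ^ (2 * al + e + 6).
Proof.
have := @card_bad_medium g P al th nu B g_gt0 nuE B_gt1 B_tau' Y0 (B ^ e) (Bp _).
move=> /leq_trans; apply.
have -> : 2 * B ^ nu %/ Y0 = 2 * B ^ e by rewrite -addnA expnD mulnA mulnK.
apply: leq_trans (leq_mul M1_le (leqnn _)) _.
have -> : 2 * B ^ (2 * al + 4) * (B * (2 * B ^ e + B ^ e)) = 6 * (B ^ (2 * al + 4) * (B * B ^ e)) by lia.
rewrite -expnS -expnD; apply: leq_trans (leq_mul (_ : 6 <= B) (leqnn _)) _.
  by apply: leq_trans (ltnW B_gt64).
by rewrite -expnS leq_pexp2l //; lia.
Qed.

(** By [h3] the number of possible squarefree parts is of order at most [B ^ e], which matches the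
    medium bound. *)
Let bad_large_le :
  #|[set x in S | B ^ e < sqpart (x.1 ^ g - x.2 ^ 2)]| <= B ^ (2 * al + e + 6).
Proof.
have := @card_bad_large g P al th nu B g_gt0 nuE B_gt1 B_tau' (B ^ e) (Bp e).
move=> /leq_trans; apply.
have e2 : 2 * e <= (2 * al + 4) * g.
  by move: nuE; rewrite mulnDl -mulnA [al * g]mulnC => <-; lia.
have -> : B ^ ((2 * al + 4) * g) %/ (B ^ e) ^ 2 = B ^ ((2 * al + 4) * g - 2 * e).
  by rewrite -{1}(subnK e2) expnD -expnM [e * 2]mulnC mulnK.
set w := B ^ (_ - _).
have w_le : w.+1 <= 2 * w by rewrite mul2n -addnn -addn1 leq_add2l Bp.
apply: leq_trans (leq_mul (leq_mul M1_le w_le) (leqnn _)) _.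
have -> : 2 * B ^ (2 * al + 4) * (2 * w) * (B * 3) = 12 * (B ^ (2 * al + 4) * (w * B)) by lia.
rewrite -expnSr -expnD; apply: leq_trans (leq_mul (_ : 12 <= B) (leqnn _)) _.
  by apply: leq_trans (ltnW B_gt64).
by rewrite -expnS leq_pexp2l //; move: h3; lia.
Qed.

(** As [nu - (th + 9) = e + 8], the candidates exceed each bad bound by [B ^ 2], so discarding the
    bad pairs costs at most one power of [B]. *)
Let card_good_ge : B ^ (2 * al + e + 7) <= #|good|.
Proof.
have P_gt0 : 0 < P by case: P P_odd.
have thnu : 2 * th + 5 <= nu by move: h4; lia.
have := card_cand_ge g_odd P_sqf P_odd al_gt0 th_gt0 nuE thnu B_gt B_al B_th B_tau'.
have -> : 2 * al + nu - (th + 9) = (2 * al + e + 6).+2 by lia.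
move=> S_ge.
have S_le : #|S| <= #|good| + (B ^ (2 * al + e + 6) + B ^ (2 * al + e + 6)).
  apply: leq_trans (leq_add (leqnn _) (leq_add bad_medium_le bad_large_le)).
  apply: leq_trans (leq_add (leqnn _) (leq_card_setU _ _)).
  apply: leq_trans (leq_card_setU _ _).
  apply: subset_leq_card; apply/subsetP => x xS; rewrite in_setU in_setU.
  rewrite [x \in good]in_set [x \in [set x in S | _ < _ <= _]]in_set.
  rewrite [x \in [set x in S | _ < _]]in_set xS /=.
  by case: leqP => //= _; case: leqP.
have := leq_trans S_ge S_le; rewrite [2 * al + e + 7]addnS !expnS; move: (B ^ (2 * al + e + 6)) #|good| => u v.
have := leq_mul B_gt1 (leqnn (B * u)); have := leq_mul B_gt1 (leqnn u); lia.
Qed.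

(** Cauchy-Schwarz with [om = 2 * al + e + 7] and [pi = 4 * al + 2 * th + 44]; [h4] and [h5] are the
    two inequalities needed between them. *)
Lemma card_good_part_ge :
  B ^ (2 * e - (2 * th + 31)) <= #|@good_part g al th nu B @: good|.
Proof.
have th_le : 2 * th <= (2 * al + 4) * g.
  by move: nuE; rewrite mulnDl -mulnA [al * g]mulnC => <-; lia.
have coll := card_collisions P g_gt0 nuE B_gt1 th_le B_tau.
have := card_sqr_le_image good (@good_part g al th nu B).
move=> /leq_trans/(_ (leq_mul (leqnn _) coll)) H.
have -> : 2 * e - (2 * th + 31) = 2 * (2 * al + e + 7) - (4 * al + 2 * th + 44).+1 by lia.
apply: (@card_image_ge #|good|) => //; try (move: h4 h5; lia).
apply: leq_trans H _; rewrite leq_mul2l leq_add2l; apply/orP; right.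
have Y0_le : Y0.+1 <= 2 * Y0 by rewrite mul2n -addnn -addn1 leq_add2l.
apply: leq_trans (_ : (2 * B ^ (2 * al + 4) * (2 * Y0)) ^ 2 * B <= _).
  by rewrite leq_mul2r leq_exp2r // leq_mul // orbT.
have -> : (2 * B ^ (2 * al + 4) * (2 * Y0)) ^ 2 * B = 16 * (B * (B ^ (2 * al + 4) * Y0) ^ 2) by lia.
rewrite -expnD -expnM -expnS; apply: leq_trans (leq_mul (_ : 16 <= B) (leqnn _)) _.
  by apply: leq_trans (ltnW B_gt64).
by rewrite -expnS leq_pexp2l //; lia.
Qed.

(** From [y <= Y0] and [m ^ g - n ^ 2 > B ^ (2 * nu)] follows [d > B ^ (2 * e)], whereas
    [m ^ g <= B ^ (3 * e)] by [h3]. *)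
Lemma good_partP (x : 'I_(B ^ (2 * al + 4)).+1 * 'I_(B ^ nu)) : x \in good ->
  let d := @good_part g al th nu B x : nat in
  [/\ squarefree d, B < d, P %| d & exists m n y,
   [/\ 1 < m, coprime m n.*2, m ^ g = n ^ 2 + y ^ 2 * d & 64 * m ^ g < d ^ 3]].
Proof.
have th_le : 2 * th <= (2 * al + 4) * g.
  by move: nuE; rewrite mulnDl -mulnA [al * g]mulnC => <-; lia.
move=> xG /=; rewrite (good_partE g_gt0 nuE B_gt1 th_le xG).
move: xG; rewrite inE => /andP[xS yY].
have [[z_gt z_le zE zyd [y0 d0 m0]] [_ _ om _ Pd]] := candP g_gt0 nuE B_gt1 xS.
have z0 : 0 < x.1 ^ g - x.2 ^ 2 by apply: leq_ltn_trans z_gt.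
set d := sfpart _ in zyd d0 Pd *; set y := sqpart _ in zyd y0 yY.
have d_gt : B ^ (2 * e) < d.
  rewrite -(@ltn_pmul2l (Y0 ^ 2)) ?expn_gt0 ?B_gt0 //.
  apply: leq_trans (_ : y ^ 2 * d <= _); last by rewrite leq_mul2r leq_exp2r // yY orbT.
  rewrite -zyd; apply: leq_ltn_trans z_gt; rewrite -expnM -expnD leq_pexp2l //; lia.
have [mlt _ _ cop _] : [/\ B ^ (2 * al) < x.1, true, true, coprime x.1 x.2 & true].
  by move: xS; rewrite inE => /and5P[].
split=> //; first exact: sfpart_squarefree.
  by apply: leq_ltn_trans d_gt; rewrite -[X in X <= _]expn1 leq_pexp2l //; move: e_gt0; clear; lia.
exists x.1, x.2, y; split.
- by apply: leq_ltn_trans mlt.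
- by rewrite -muln2 coprimeMr cop coprimen2.
- by rewrite -zyd.
- have mg : x.1 ^ g <= B ^ (3 * e).
    by apply: leq_trans (_ : (B ^ (2 * al + 4)) ^ g <= _); [rewrite leq_exp2r // -ltnS|rewrite -expnM leq_pexp2l].
  apply: leq_ltn_trans (leq_mul (leqnn _) mg) _.
  apply: leq_trans (_ : B ^ (3 * e).+1 <= _); first by rewrite expnS ltn_pmul2r.
  apply: leq_trans (_ : (B ^ (2 * e)) ^ 3 <= _); last by rewrite leq_exp2r // ltnW.
  by rewrite -expnM leq_pexp2l //; move: e_gt0; clear; lia.
Qed.

End Main.

From mathcomp Require Import boolp classical_sets reals topology normedtype exp.

Local Open Scope ring_scope.

(** * Class groups of imaginary quadratic fields *)

(** The squared denominator of [w] is coprime to its numerator, so it divides [d]. *)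
Lemma rat_int_of_sqr_mul (d : nat) (w : rat) :
  squarefree d -> d%:R * w ^+ 2 \is a Num.int -> w \is a Num.int.
Proof.
move=> sqf /intrP[z zE].
have q0 : (denq w)%:~R != 0 :> rat by rewrite intr_eq0 denq_neq0.
have e : d%:Z * numq w ^+ 2 = z * denq w ^+ 2.
  apply: (@intr_inj rat); rewrite !intrM -zE; have := divq_num_den w.
  move: (denq w) (numq w) q0 => b a b0 <-.
  by rewrite -[d%:~R]/(d%:R); field.
have : (`|denq w| ^ 2 %| d)%N.
  rewrite -(@Gauss_dvdl _ d (`|numq w| ^ 2)); last first.
    by rewrite coprime_sym coprimeXl // coprimeXr // coprime_num_den.
  apply/dvdnP; exists `|z|%N.
  by have := congr1 absz e; rewrite !abszM absz_nat !mulnn.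
move=> /sqf e1; rewrite -(divq_num_den w).
have -> : denq w = 1 by rewrite -absz_denq e1.
by rewrite divr1 intr_int.
Qed.

Section QuadInt.
Variable d : nat.
Local Notation K := (quad_field d).
Local Notation O := (quad_int d).
Local Notation s := (sqrtC (- d%:R) : algC).

Lemma sqrtCN_conj : s ^* = - s.
Proof.
have /eqP : s^* ^+ 2 = s ^+ 2 by rewrite -rmorphXn /= !sqrtCK rmorphN rmorph_nat.
rewrite eqf_sqr => /orP[/eqP/CrealP sR|/eqP //].
have : 0 <= s ^+ 2 by rewrite real_exprn_even_ge0.
rewrite sqrtCK oppr_ge0 lern0 => /eqP ->.
by rewrite oppr0 sqrtC0 rmorph0 oppr0.
Qed.

Lemma sqrtCN_mul : s * s = - d%:R.
Proof. by rewrite -expr2 sqrtCK. Qed.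

Lemma quad_int_sqrt : O s.
Proof.
apply: quad_int_crit.
- by exists 0, 1; rewrite rmorph0 rmorph1 add0r mul1r.
- by rewrite sqrtCN_conj subrr rpred0.
- by rewrite sqrtCN_conj mulrN sqrtCN_mul opprK rpred_nat.
Qed.

Lemma quad_int_nat n : O n%:R.
Proof. by apply: quad_int_int; rewrite rpred_nat. Qed.

Lemma quad_intN x : O x -> O (- x).
Proof.
by move=> Ox; rewrite -mulN1r; apply: quad_intM => //; apply: quad_int_int; rewrite rpredN1.
Qed.

Lemma quad_int_norm_int x : O x -> x * x^* \is a Num.int.
Proof.
move=> Ox; apply: (@quad_int_rat d).
  by apply: quad_intM => //; apply: quad_int_conj.
by apply: (@quad_field_norm d); case: Ox.
Qed.

Lemma quad_int_real x : O x -> x^* = x -> x \is a Num.int.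
Proof.
move=> Ox xR; apply: (quad_int_rat Ox).
have := quad_field_trace (proj1 Ox); rewrite xR -mulr2n -mulr_natr => h.
by rewrite -(mulfK (_ : 2%:R != 0) x) ?pnatr_eq0 // rpred_div // rpred_nat.
Qed.

(** Write [x = a + b * s]. Both [2 * a] and [2 * b] are integers, and four times the norm is
    [(2 * a) ^ 2 + d * (2 * b) ^ 2], at least [d] unless [b = 0]. *)
Lemma quad_int_norm_ge x : squarefree d -> O x ->
  x^* = x \/ d%:R <= 4 * (x * x^*).
Proof.
move=> sqf Ox; have [[a [b xE]] _] := Ox.
have ratc (c : rat) : (ratr c : algC)^* = ratr c by rewrite conj_Crat ?Crat_rat.
have xcE : x^* = ratr a - ratr b * s.
  rewrite xE; move: (ratc a) (ratc b); move: (ratr a : algC) (ratr b : algC) => u v uE vE.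
  by rewrite rmorphD rmorphM /= sqrtCN_conj uE vE mulrN.
have [b0|b0] := eqVneq b 0.
  by left; rewrite xcE xE b0 rmorph0 mul0r oppr0.
right; have tZ : x + x^* \is a Num.int.
  apply: (@quad_int_rat d); first by apply: quad_intD => //; apply: quad_int_conj.
  by apply: (@quad_field_trace d); case: Ox.
have nE : 4 * (x * x^*) = ratr (2 * a) ^+ 2 + d%:R * ratr (2 * b) ^+ 2.
  rewrite xcE xE !rmorphM rmorph_nat /=; move: sqrtCN_mul.
  move: (sqrtC _) (ratr a) (ratr b) => t u v tt.
  have -> : d%:R = - (t * t) by rewrite tt opprK.
  by ring.
have aZ : ratr (2 * a) \is a @Num.int algC.
  move: tZ; rewrite xcE xE addrACA subrr addr0 rmorphM rmorph_nat.
  by rewrite mulrDl mul1r.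
have wZ : 2 * b \is a Num.int.
  apply: (rat_int_of_sqr_mul sqf).
  have : d%:R * ratr (2 * b) ^+ 2 \is a @Num.int algC.
    have -> : d%:R * ratr (2 * b) ^+ 2 = 4 * (x * x^*) - ratr (2 * a) ^+ 2 :> algC.
      by rewrite nE addrC addKr.
    apply: rpredB; last exact: rpredX.
    by apply: rpredM; [exact: rpred_nat|exact: quad_int_norm_int].
  rewrite -(rmorph_nat (@ratr algC)) -rmorphXn -rmorphM /=.
  by move=> /intrP[z]; rewrite -(rmorph_int (@ratr algC)) => /fmorph_inj ->; rewrite intr_int.
have {wZ} [z zE] : exists z : int, ratr (2 * b) = z%:~R :> algC.
  by have /intrP[z ->] := wZ; exists z; rewrite rmorph_int.
have {aZ} [u uE] : exists u : int, ratr (2 * a) = u%:~R :> algC by apply/intrP.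
have z0 : z != 0.
  apply/eqP => z0; move/eqP: zE; rewrite z0 fmorph_eq0 mulf_eq0 (negPf b0).
  by rewrite orbF pnatr_eq0.
rewrite nE uE zE -!rmorphXn /= -[d%:R]/(d%:Z%:~R) -intrM -intrD ler_int.
have z1 : 1 <= z ^+ 2 by have := sqrf_eq0 z; have := sqr_ge0 z; lia.
by rewrite -[leLHS]add0r lerD ?sqr_ge0 // ler_peMr.
Qed.

Lemma quad_int_unit_norm x y : O x -> O y -> x * y = 1 -> x * x^* = 1.
Proof.
move=> Ox Oy xy.
have /intrP[a aE] := quad_int_norm_int Ox.
have /intrP[b bE] := quad_int_norm_int Oy.
have a0 : 0 <= a by rewrite -(ler0z algC) -aE mul_conjC_ge0.
have b0 : 0 <= b by rewrite -(ler0z algC) -bE mul_conjC_ge0.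
have /intr_inj ab : (a * b)%:~R = 1%:~R :> algC.
  by rewrite intrM -aE -bE mulrACA -rmorphM /= xy rmorph1 mulr1.
have -> : x * x^* = 1%:~R.
  rewrite aE; congr (_%:~R).
  case: a b a0 b0 ab {aE bE} => // a [b|//] _ _ [] /eqP.
  by rewrite muln_eq1 => /andP[/eqP->].
by [].
Qed.

Lemma quad_int_unit x y : squarefree d -> (4 < d)%N -> O x -> O y -> x * y = 1 ->
  x = 1 \/ x = -1.
Proof.
move=> sqf d4 Ox Oy xy; have n1 := quad_int_unit_norm Ox Oy xy.
have [xR|] := quad_int_norm_ge sqf Ox; last first.
  by rewrite n1 mulr1 ler_nat leqNgt d4.
move: n1; rewrite xR -expr2 => /eqP; rewrite -subr_eq0 subr_sqr_1 mulf_eq0.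
by rewrite subr_eq0 addr_eq0 => /orP[]/eqP; [left|right].
Qed.

Lemma principal_set_eq a b : a != 0 -> b != 0 ->
  principal_set d a = principal_set d b ->
  exists e f, [/\ O e, O f, e * f = 1 & a = b * e].
Proof.
move=> a0 b0 ab.
have : principal_set d b a by rewrite -ab; exists 1; rewrite ?mulr1 //; apply: quad_int1.
have : principal_set d a b by rewrite ab; exists 1; rewrite ?mulr1 //; apply: quad_int1.
move=> [f Of fE] [e Oe eE]; exists e, f; split=> //.
by apply: (mulfI b0); rewrite mulrA eE fE mulr1.
Qed.

End QuadInt.

(** * Ideals with prescribed powers *)

Section Classes.
Variable d : nat.
Local Notation K := (quad_field d).
Local Notation O := (quad_int d).
Local Notation s := (sqrtC (- d%:R) : algC).

HB.instance Definition _ := Monoid.isComLaw.Build (frac_ideal d) (unit_ideal d)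
  (@ideal_mul d) (@ideal_mulA d) (@ideal_mulC d) (@ideal_mul1 d).

Lemma ideal_classM (I J : frac_ideal d) :
  ideal_class (ideal_mul I J) = ideal_class I + ideal_class J.
Proof. by rewrite -class_addE. Qed.

Lemma ideal_class1 : ideal_class (unit_ideal d) = 0.
Proof. by []. Qed.

Lemma ideal_class_eq0 (I : frac_ideal d) : ideal_class I = 0 <-> is_principal I.
Proof.
have V1 : ideal_inv (unit_ideal d) = unit_ideal d.
  by apply: ideal_inv_uniq; apply: ideal_mul1.
rewrite -ideal_class1; split=> [/ideal_classP/asboolP|pI].
  by rewrite V1 ideal_mulC ideal_mul1.
by apply/ideal_classP/asboolP; rewrite V1 ideal_mulC ideal_mul1.
Qed.

Definition ideal_pow (I : frac_ideal d) n := iterop n (@ideal_mul d) I (unit_ideal d).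

Lemma ideal_powS I n : ideal_pow I n.+1 = ideal_mul I (ideal_pow I n).
Proof. by case: n => //=; rewrite [RHS]ideal_mulC ideal_mul1. Qed.

Lemma ideal_class_pow I n : ideal_class (ideal_pow I n) = ideal_class I *+ n.
Proof.
elim: n => [|n IH]; first by rewrite mulr0n.
by rewrite ideal_powS ideal_classM IH mulrS.
Qed.

Lemma ideal_powM I m n : ideal_pow I (m * n) = ideal_pow (ideal_pow I m) n.
Proof.
have powD i j : ideal_pow I (i + j) = ideal_mul (ideal_pow I i) (ideal_pow I j).
  elim: i => [|i IH]; first by rewrite add0n ideal_mul1.
  by rewrite addSn !ideal_powS IH ideal_mulA.
by elim: n => [|n IH]; [rewrite muln0|rewrite mulnS powD IH ideal_powS].
Qed.

Lemma ideal_pow_principal I n b : ideal_set I = principal_set d b -> K b -> b != 0 ->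
  ideal_set (ideal_pow I n) = principal_set d (b ^+ n).
Proof.
move=> Ib Kb b0; have -> : I = principal Kb b0 by apply/val_inj.
elim: n => [|n IH]; first by rewrite expr0.
have Kn : K (b ^+ n).
  by elim: n {IH} => [|n IH]; [case: (quad_int1 d)|rewrite exprS; apply: quad_fieldM].
have n0 : b ^+ n != 0 by rewrite expf_neq0.
rewrite ideal_powS.
have -> : ideal_pow (principal Kb b0) n = principal Kn n0 by apply/val_inj.
by rewrite principalM exprS.
Qed.

Definition gen2 (x y : algC) : set algC :=
  [set z | exists a b, [/\ O a, O b & z = x * a + y * b]].

Lemma gen2_l x y : gen2 x y x.
Proof.
by exists 1, 0; split; [exact: quad_int1|exact: quad_int0|rewrite mulr1 mulr0 addr0].
Qed.

Lemma gen2_r x y : gen2 x y y.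
Proof.
by exists 0, 1; split; [exact: quad_int0|exact: quad_int1|rewrite mulr1 mulr0 add0r].
Qed.

Lemma gen2P x y : O x -> O y -> x != 0 -> is_frac_ideal d (gen2 x y).
Proof.
move=> Ox Oy x0.
have sub z : gen2 x y z -> O z.
  by move=> [a [b [Oa Ob ->]]]; apply: quad_intD; apply: quad_intM.
split.
- by move=> z /sub[].
- by exists 0, 0; split; [exact: quad_int0|exact: quad_int0|rewrite !mulr0 addr0].
- move=> _ _ [a [b [Oa Ob ->]]] [a' [b' [Oa' Ob' ->]]].
  by exists (a + a'), (b + b'); split; [exact: quad_intD|exact: quad_intD|ring].
- move=> c _ Oc [a [b [Oa Ob ->]]].
  by exists (c * a), (c * b); split; [exact: quad_intM|exact: quad_intM|ring].
- by exists x => //; apply: gen2_l.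
- exists 1; split; [exact: quad_int1|exact: oner_neq0|].
  by move=> z; rewrite mul1r; apply: sub.
Qed.

Lemma gen2_sub (I : set algC) x y : is_frac_ideal d I -> I x -> I y ->
  (gen2 x y `<=` I)%classic.
Proof.
move=> FI Ix Iy _ [a [b [Oa Ob ->]]].
by apply: (fi_add FI); rewrite mulrC; apply: (fi_scale FI).
Qed.

(* The inverse of [2n] modulo [m] puts [alpha] in [(m^(j+1), m alpha, alpha^2)]. *)
Lemma gen2_mul (g m n y j : nat) : coprime m n.*2 -> (0 < m)%N -> (j.+1 <= g)%N ->
  (m ^ g = n ^ 2 + y ^ 2 * d)%N ->
  let al := n%:R + y%:R * s in
  set_mul (gen2 m%:R al) (gen2 (m ^ j)%:R al) = gen2 (m ^ j.+1)%:R al.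
Proof.
move=> cop m_gt0 jg e al.
have Oal : O al.
  apply: quad_intD; first exact: quad_int_nat.
  by apply: quad_intM; [exact: quad_int_nat|exact: quad_int_sqrt].
have FI i : is_frac_ideal d (gen2 (m ^ i)%:R al).
  by apply: gen2P => //; [exact: quad_int_nat|rewrite pnatr_eq0 -lt0n expn_gt0 m_gt0].
have F1 : is_frac_ideal d (gen2 m%:R al) by have := FI 1%N; rewrite expn1.
have FM := set_mul_ideal F1 (FI j).
rewrite eqEsubset; split.
  apply: set_mul_min; [exact: (fi_zero (FI _))|exact: (fi_add (FI _))|].
  move=> _ _ [a [b [Oa Ob ->]]] [a' [b' [Oa' Ob' ->]]].
  exists (a * a'), (m%:R * a * b' + b * (m ^ j)%:R * a' + al * b * b'); split.
  - exact: quad_intM.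
  - by do !apply: quad_intD; do !apply: quad_intM => //; exact: quad_int_nat.
  - by rewrite expnS natrM; ring.
apply: gen2_sub => //.
  by rewrite expnS natrM; apply: set_mul_gen; apply: gen2_l.
have [u [v uv]] : exists u v : int, u * m%:Z + v * (n.*2)%:Z = 1.
  by have [u [v uv]] := Bezoutz m%:Z (n.*2)%:Z; exists u, v; rewrite uv /gcdz /= (eqP cop).
(* The trace of [al] is [2 n] and its norm [m ^ g], so [al * al + m ^ g = 2 n al]; this is the
   Bezout relation times [al]. *)
have alE : al = u%:~R * (m%:R * al) + v%:~R * (al * al) + v%:~R * (m ^ g)%:R.
  have uvC : u%:~R * m%:R + v%:~R * (n%:R + n%:R) = 1 :> algC.
    by have := congr1 (fun z : int => z%:~R : algC) uv; rewrite intrD !intrM -addnn /= -[(n + n)%N%:~R]/((n + n)%:R) natrD.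
  rewrite e natrD natrM !natrX.
  transitivity ((u%:~R * m%:R + v%:~R * (n%:R + n%:R)) * al); first by rewrite uvC mul1r.
  move: (sqrtCN_mul d); rewrite /al; move: (sqrtC _) => t tt.
  by have -> : d%:R = - (t * t) by [rewrite tt opprK]; ring.
rewrite [X in set_mul _ _ X]alE; apply: (fi_add FM); first apply: (fi_add FM).
- apply: (fi_scale FM); first by apply: quad_int_int; rewrite intr_int.
  by rewrite mulrC [al * _]mulrC; apply: set_mul_gen; [exact: gen2_l|exact: gen2_r].
- apply: (fi_scale FM); first by apply: quad_int_int; rewrite intr_int.
  by apply: set_mul_gen; exact: gen2_r.
- apply: (fi_scale FM); first by apply: quad_int_int; rewrite intr_int.
  rewrite -(subnK jg) expnD natrM; apply: (fi_scale FM); first exact: quad_int_nat.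
  by rewrite expnS natrM; apply: set_mul_gen; apply: gen2_l.
Qed.

(** For [A = (m, al)] the powers are [A ^ j = (m ^ j, al)], and at [j = g] the first generator is a
    multiple of [al], its norm being [m ^ g]. *)
Lemma ideal_root (g m n y : nat) : coprime m n.*2 -> (0 < m)%N -> (0 < g)%N ->
  (m ^ g = n ^ 2 + y ^ 2 * d)%N ->
  exists A : frac_ideal d, ideal_set (ideal_pow A g) = principal_set d (n%:R + y%:R * s).
Proof.
move=> cop m_gt0 g_gt0 e; set al := _ + _.
have Oal : O al.
  apply: quad_intD; first exact: quad_int_nat.
  by apply: quad_intM; [exact: quad_int_nat|exact: quad_int_sqrt].
have FA : is_frac_ideal d (gen2 m%:R al).
  by apply: gen2P => //; [exact: quad_int_nat|rewrite pnatr_eq0 -lt0n].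
exists (FracIdeal (asboolT FA)).
have pw j : (j < g)%N ->
    ideal_set (ideal_pow (FracIdeal (asboolT FA)) j.+1) = gen2 (m ^ j.+1)%:R al.
  elim: j => [|j IH] jg; first by rewrite expn1.
  by rewrite ideal_powS /= IH 1?ltnW //; apply: (@gen2_mul g).
case: g g_gt0 e pw => // g _ e pw; rewrite pw //.
have nE : (m ^ g.+1)%:R = al * (n%:R - y%:R * s).
  rewrite e natrD natrM !natrX /al.
  move: (sqrtCN_mul d); move: (sqrtC _) => t tt.
  by have -> : d%:R = - (t * t) by [rewrite tt opprK]; ring.
rewrite eqEsubset; split.
  move=> _ [a [b [Oa Ob ->]]]; exists ((n%:R - y%:R * s) * a + b); last by rewrite nE; ring.
  apply: quad_intD => //; apply: quad_intM => //; apply: quad_intD; first exact: quad_int_nat.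
  apply: quad_intN; apply: quad_intM; [exact: quad_int_nat|exact: quad_int_sqrt].
move=> _ [x Ox <-]; exists 0, x; split=> //; first exact: quad_int0.
by rewrite mulr0 add0r.
Qed.

(** The ideal is [(p, s)]. Its square contains [p ^ 2] and [d], whose greatest common divisor is [p]
    because [d] is squarefree. *)
Lemma ramified_ideal p : squarefree d -> prime p -> (p %| d)%N ->
  exists I : frac_ideal d, ideal_set (ideal_mul I I) = principal_set d p%:R.
Proof.
move=> sqf pp pd; have p0 : p%:R != 0 :> algC by rewrite pnatr_eq0 -lt0n prime_gt0.
have FI : is_frac_ideal d (gen2 p%:R s).
  by apply: gen2P => //; [exact: quad_int_nat|exact: quad_int_sqrt].
exists (FracIdeal (asboolT FI)) => /=.
have FM := set_mul_ideal FI FI.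
have dE : (d = (d %/ p) * p)%N by rewrite divnK.
have sE : s * s = p%:R * - (d %/ p)%:R by rewrite sqrtCN_mul {1}dE natrM mulrC mulrN.
rewrite eqEsubset; split.
  have FP : is_frac_ideal d (principal_set d p%:R).
    by apply: principal_setP => //; case: (quad_int_nat d p).
  apply: set_mul_min; [exact: (fi_zero FP)|exact: (fi_add FP)|].
  move=> _ _ [a [b [Oa Ob ->]]] [a' [b' [Oa' Ob' ->]]].
  exists (p%:R * a * a' + s * a * b' + s * a' * b - (d %/ p)%:R * b * b').
    have Os := quad_int_sqrt d.
    do !apply: quad_intD; do ?apply: quad_intN; do !apply: quad_intM => //; exact: quad_int_nat.
  have -> : (p%:R * a + s * b) * (p%:R * a' + s * b') =
     p%:R * p%:R * a * a' + p%:R * s * a * b' + p%:R * s * a' * b + (s * s) * b * b'.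
    by move: (sqrtC _) => t; ring.
  by rewrite sE; move: (sqrtC _) => t; ring.
move=> _ [x Ox <-]; rewrite mulrC; apply: (fi_scale FM) => //.
have cop : coprime p (d %/ p).
  rewrite prime_coprime //; apply/negP => pdp.
  have : (p ^ 2 %| d)%N by rewrite dE -mulnn dvdn_mul.
  by move=> /sqf p1; rewrite p1 in pp.
have [u [v uv]] : exists u v : int, u * p%:Z + v * (d %/ p)%N%:Z = 1.
  by have [u [v uv]] := Bezoutz p%:Z (d %/ p)%N%:Z; exists u, v; rewrite uv /gcdz /= (eqP cop).
have uvC : u%:~R * p%:R + v%:~R * (d %/ p)%:R = 1 :> algC.
  by have := congr1 (fun z : int => z%:~R : algC) uv; rewrite intrD !intrM.
have pE : p%:R = u%:~R * (p%:R * p%:R) + - v%:~R * (s * s).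
  transitivity (p%:R * (u%:~R * p%:R + v%:~R * (d %/ p)%:R) : algC); first by rewrite uvC mulr1.
  by rewrite sE; ring.
rewrite [X in set_mul _ _ X]pE; apply: (fi_add FM); apply: (fi_scale FM).
- by apply: quad_int_int; rewrite intr_int.
- by apply: set_mul_gen; apply: gen2_l.
- by apply: quad_int_int; rewrite rpredN intr_int.
- by apply: set_mul_gen; apply: gen2_r.
Qed.

End Classes.

(** * A class of order [g] and independent classes of order two *)

Lemma Aint_of_exp (h : nat) (x : algC) : (0 < h)%N -> x ^+ h \in Aint -> x \in Aint.
Proof.
move=> h0 xh; have [q [qE qm] qr] := minCpolyP (x ^+ h).
apply: (@root_monic_Aint (minCpoly (x ^+ h) \Po 'X^h)).
- by rewrite rootE horner_comp hornerXn -rootE root_minCpoly.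
- rewrite monicE lead_coef_comp ?size_polyXn ?ltnS //.
  by rewrite lead_coefXn expr1n mulr1 qE lead_coef_map (monicP qm) rmorph1.
- by apply: polyOver_comp => //; rewrite polyOverXn.
Qed.

Lemma odd_divisor_gt2 g e : odd g -> (e %| g)%N -> (e < g)%N -> (2 < g %/ e)%N.
Proof.
move=> og eg lt; move: og lt (divnK eg).
by case: (g %/ e)%N => [|[|[|h]]] og lt gE; move: og lt; rewrite -gE; lia.
Qed.

(** If [A ^ e = (b)] for a proper divisor [e], then [b ^ h] is [al] times a unit with
    [h = g / e >= 3]. A non-real [b] violates the norm bound; a real one contradicts the coprimality
    of [m] and [2 n]. *)
Lemma class_of_order (d g m n y : nat) : squarefree d -> odd g -> (1 < m)%N ->
  coprime m n.*2 -> (m ^ g = n ^ 2 + y ^ 2 * d)%N -> (64 * m ^ g < d ^ 3)%N ->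
  exists a : class_group d,
    a *+ g = 0 /\ forall e, (0 < e)%N -> (e %| g)%N -> (e < g)%N -> a *+ e <> 0.
Proof.
move=> sqf og m1 cop eq bnd; have g0 : (0 < g)%N by case: g og {eq bnd}.
have [A AE] := ideal_root cop (ltnW m1) g0 eq.
move: AE; set al := _ + _ => AE.
have Oal : quad_int d al.
  apply: quad_intD; first exact: quad_int_nat.
  by apply: quad_intM; [exact: quad_int_nat|exact: quad_int_sqrt].
have alc : al^* = n%:R - y%:R * sqrtC (- d%:R).
  by rewrite rmorphD rmorphM /= !rmorph_nat sqrtCN_conj mulrN.
have alN : al * al^* = (m ^ g)%:R.
  rewrite alc eq natrD natrM !natrX /al.
  move: (sqrtCN_mul d); move: (sqrtC _) => t tt.
  by have -> : d%:R = - (t * t) by [rewrite tt opprK]; ring.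
have al0 : al != 0.
  apply/eqP => al0; move/eqP: alN; rewrite al0 mul0r eq_sym pnatr_eq0.
  by rewrite expn_eq0 -leqn0 leqNgt (ltnW m1).
exists (ideal_class A); rewrite -ideal_class_pow; split.
  by apply/ideal_class_eq0; exists al, (proj1 Oal), al0; apply/val_inj.
move=> e e0 eg elt; rewrite -ideal_class_pow => /ideal_class_eq0[b [Kb [b0 bE]]].
have bE' : ideal_set (ideal_pow A e) = principal_set d b by rewrite bE.
have h2 := odd_divisor_gt2 og eg elt; set h := (g %/ e)%N in h2.
have := ideal_pow_principal h bE' Kb b0.
rewrite -ideal_powM mulnC divnK // AE.
move=> /esym/principal_set_eq -/(_ _ al0)[|u [v [Ou Ov uv bh]]]; first by rewrite expf_neq0.
have Ob : quad_int d b.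
  have bn : b ^+ h \in Aint by rewrite bh rpredM //; [case: Oal|case: Ou].
  by split=> //; apply: (@Aint_of_exp h) => //; lia.
have uN := quad_int_unit_norm Ou Ov uv.
have bN : (b * b^*) ^+ h = (m ^ g)%:R.
  by rewrite exprMn -rmorphXn /= bh rmorphM mulrACA alN uN mulr1.
have /intrP[z zE] := quad_int_norm_int Ob.
have z0 : 0 <= z by rewrite -(ler0z algC) -zE mul_conjC_ge0.
case: z z0 zE => // z _ zE.
have zh : (z ^ h = m ^ g)%N.
  by apply/eqP; rewrite -(eqr_nat algC) natrX -bN zE.
(* Non-real case: [d <= 4 * z] and [z ^ 3 <= z ^ h = m ^ g] contradict [64 * m ^ g < d ^ 3]. *)
have [bR|] := quad_int_norm_ge sqf Ob; last first.
  rewrite zE -[z%:~R]/(z%:R) -natrM ler_nat => dz.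
  have zpos : (0 < z)%N.
    by case: z {zE dz} zh => //; rewrite exp0n; [case: (m) m1 => // m' _ /esym/eqP; rewrite expn_eq0|lia].
  have : (z ^ 3 <= m ^ g)%N by rewrite -zh leq_pexp2l.
  have : (d ^ 3 <= (4 * z) ^ 3)%N by rewrite leq_exp2r.
  rewrite expnMn; move: bnd; lia.
have /intrP[x xE] := quad_int_real Ob bR.
have bd : (`|x| ^ 2 = z)%N.
  have : (x ^+ 2)%:~R = z%:~R :> algC by rewrite rmorphXn /= -xE -zE bR expr2.
  by move/intr_inj => /(congr1 absz); rewrite abszX absz_nat.
have xm : (`|x| %| m ^ g)%N.
  by rewrite -zh -bd -expnM dvdn_exp //; lia.
(* A real [b] divides both [al] and its conjugate, hence their sum [2 n]. *)
have [w wE] : exists w, w \in Aint /\ b * w = n.*2%:R.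
  exists (b ^+ h.-1 * v + (b ^+ h.-1 * v)^*); split.
    have [_ vA] := Ov; have [_ bA] := Ob.
    by rewrite rpredD ?Aint_aut // rpredM // rpredX.
  have bS : b * (b ^+ h.-1 * v) = al.
    by rewrite mulrA -exprS prednK ?bh -?mulrA ?uv ?mulr1 //; lia.
  have bSc : b * (b ^+ h.-1 * v)^* = al^* by rewrite -bS [in RHS]rmorphM /= bR.
  rewrite mulrDr bS bSc alc /al -addnn natrD.
  by move: (sqrtC _) => t; ring.
have xn : (`|x| %| n.*2)%N.
  case: wE => wA wE; have x0 : x != 0 by rewrite -(intr_eq0 algC) -xE.
  have wQ : w \in Crat.
    have -> : w = n.*2%:R / b by rewrite -wE mulrAC divff ?mul1r.
    by rewrite xE rpred_div ?rpred_nat ?rpred_int.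
  have /intrP[q qE] := Cint_rat_Aint wQ wA.
  have : (x * q)%:~R = (n.*2)%:~R :> algC by rewrite intrM -xE -qE.
  move/intr_inj => /(congr1 absz); rewrite abszM absz_nat => <-.
  exact: dvdn_mulr.
have : (`|x| %| 1)%N.
  by rewrite -(eqP (coprimeXl g cop)) dvdn_gcd xm.
rewrite dvdn1 => /eqP x1; move: zh; rewrite -bd x1 exp1n => /esym/eqP.
by rewrite exp1n; have := ltn_expl g m1; case: (m ^ g)%N => // -[|//]; lia.
Qed.

(** With [d = c * D] the product is [c * D ^ 2], so [c] is a square dividing [d]. *)
Lemma squarefree_sqr_eq1 (D d z : nat) :
  squarefree d -> (D %| d)%N -> (D * d = z ^ 2)%N -> (0 < d)%N -> D = d.
Proof.
move=> sqf /dvdnP[c cE] e d0.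
have D0 : (0 < D)%N by move: d0; rewrite cE muln_gt0 => /andP[].
have e' : (D ^ 2 * c = z ^ 2)%N by rewrite -e cE; ring.
have /dvdnP[w wE] : (D %| z)%N by rewrite -(@dvdn_pexp2r _ _ 2) // -e' dvdn_mulr.
have cw : (c = w ^ 2)%N.
  by apply/eqP; rewrite -(@eqn_pmul2l (D ^ 2)) ?expn_gt0 ?D0 // e' wE expnMn mulnC.
have /sqf w1 : (w ^ 2 %| d)%N by rewrite cE -cw dvdn_mulr.
by rewrite cE cw w1 mul1n.
Qed.

(** A relation over [S] makes the product of its ramified ideals some [(b)], so [b ^ 2] is [D] or
    [- D], with [D] the product of the primes in [S]. For nonempty [S], squarefreeness and [D < d]
    exclude both. *)
Lemma two_torsion_embeds (d l : nat) (p : 'I_l -> nat) :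
  squarefree d -> (4 < d)%N -> injective p -> (forall i, prime (p i)) ->
  (\prod_i p i %| d)%N -> (\prod_i p i < d)%N ->
  exists c : 'I_l -> class_group d, (forall i, c i *+ 2 = 0) /\
    forall S : {set 'I_l}, \sum_(i in S) c i = 0 -> S = finset.set0.
Proof.
move=> sqf d4 pinj pp pd plt.
have pid i : (p i %| d)%N.
  by apply: dvdn_trans pd; rewrite (bigD1 i) //= dvdn_mulr.
have exI i : exists I : frac_ideal d, ideal_set (ideal_mul I I) = principal_set d (p i)%:R.
  exact: ramified_ideal.
pose I i := projT1 (cid (exI i)).
have p0 i : (p i)%:R != 0 :> algC by rewrite pnatr_eq0 -lt0n prime_gt0.
have Kp i : quad_field d (p i)%:R by case: (quad_int_nat d (p i)).
have IE i : ideal_mul (I i) (I i) = principal (Kp i) (p0 i).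
  by apply/val_inj; rewrite /I; case: cid.
have classB (S : {set 'I_l}) (F : 'I_l -> frac_ideal d) :
    ideal_class (\big[@ideal_mul d/unit_ideal d]_(i in S) F i) = \sum_(i in S) ideal_class (F i).
  exact: (big_morph _ (@ideal_classM d) (@ideal_class1 d)).
exists (fun i => ideal_class (I i)); split=> [i|S].
  rewrite mulr2n -ideal_classM; apply/ideal_class_eq0.
  by rewrite IE; exists (p i)%:R, (Kp i), (p0 i).
rewrite -classB => /ideal_class_eq0[b [Kb [b0 bE]]].
pose D := (\prod_(i in S) p i)%N.
have D0 : (0 < D)%N by rewrite prodn_gt0 // => i; apply: prime_gt0.
have DP : (D %| \prod_i p i)%N.
  by rewrite (bigID (mem S)) /= dvdn_mulr.
have Dd : (D %| d)%N := dvdn_trans DP pd.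
have Dlt : (D < d)%N.
  apply: leq_ltn_trans plt; apply: dvdn_leq => //.
  by rewrite prodn_gt0 // => i; apply: prime_gt0.
have sq : ideal_set (ideal_mul (\big[@ideal_mul d/unit_ideal d]_(i in S) I i)
            (\big[@ideal_mul d/unit_ideal d]_(i in S) I i)) = principal_set d D%:R.
  rewrite -big_split /D /=.
  have DK : quad_field d D%:R by case: (quad_int_nat d D).
  suff [h ->] : exists h, \big[@ideal_mul d/unit_ideal d]_(i in S) ideal_mul (I i) (I i) = principal DK h.
    by [].
  have DN : D%:R != 0 :> algC by rewrite pnatr_eq0 -lt0n.
  exists DN; apply/val_inj; rewrite /= /D.
  suff [] : (\big[@ideal_mul d/unit_ideal d]_(i in S) ideal_mul (I i) (I i) : set algC) =
          principal_set d (\prod_(i in S) p i)%:R /\ (0 < \prod_(i in S) p i)%N by [].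
  elim/big_rec2: _ => [//|i x J _ [IH x0]].
  have Kx : quad_field d x%:R by case: (quad_int_nat d x).
  have xN : x%:R != 0 :> algC by rewrite pnatr_eq0 -lt0n.
  have -> : J = principal Kx xN by apply/val_inj.
  by rewrite IE principalM muln_gt0 x0 prime_gt0 //= natrM.
move: sq; rewrite bE principalM /= => /principal_set_eq[||u [v [Ou Ov uv bb]]].
- by rewrite mulf_neq0.
- by rewrite pnatr_eq0 -lt0n.
have Ob : quad_int d b.
  have bn : b ^+ 2 \in Aint by rewrite expr2 bb rpredM //; [case: (quad_int_nat d D)|case: Ou].
  by split=> //; apply: (@Aint_of_exp 2).
have Dsq : forall z : nat, (D = z ^ 2)%N -> D = 1%N.
  by move=> z zE; rewrite zE (sqf z) // -zE.
apply/eqP; rewrite -finset.subset0; apply/fintype.subsetP => i iS; exfalso.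
have D1 : (1 < D)%N.
  rewrite /D (bigD1 i) //=.
  apply: leq_trans (prime_gt1 (pp i)) _; rewrite leq_pmulr // prodn_gt0 // => j.
  exact: prime_gt0.
have bc : b^* = b \/ b^* = - b.
  have : (b^*) ^+ 2 == b ^+ 2.
    rewrite -rmorphXn /= expr2 bb rmorphM rmorph_nat /=.
    by case: (quad_int_unit sqf d4 Ou Ov uv) => ->; rewrite ?rmorphN rmorph1.
  by rewrite eqf_sqr => /orP[/eqP|/eqP]; [left|right].
have bN : 0 < b * b^* by rewrite mul_conjC_gt0.
have DC : (0 : algC) < D%:R by rewrite ltr0n.
have [uE|uE] := quad_int_unit sqf d4 Ou Ov uv.
  have bR : b^* = b.
    case: bc => // bc; move: bN; rewrite bc mulrN bb uE mulr1 oppr_gt0 => /(lt_trans DC).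
    by rewrite ltxx.
  rewrite uE mulr1 in bb.
  have /intrP[x xE] := quad_int_real Ob bR.
  have : (x ^+ 2)%:~R = D%:~R :> algC by rewrite rmorphXn /= -xE expr2 bb.
  move/intr_inj => /(congr1 absz); rewrite abszX absz_nat => /esym/Dsq DD.
  by rewrite DD in D1.
have bR : b^* = - b.
  case: bc => // bc; move: bN; rewrite bc bb uE mulrN1 oppr_gt0 => /(lt_trans DC).
  by rewrite ltxx.
(* With the sign minus, [b * s] is a rational integer with square [D * d], which would force
   [D = d]. *)
have Obs : quad_int d (b * sqrtC (- d%:R)) by apply: quad_intM => //; apply: quad_int_sqrt.
have bsR : (b * sqrtC (- d%:R))^* = b * sqrtC (- d%:R).
  by rewrite rmorphM /= bR sqrtCN_conj mulrNN.
have /intrP[x xE] := quad_int_real Obs bsR.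
have : (x ^+ 2)%:~R = (D * d)%N%:~R :> algC.
  rewrite rmorphXn /= -xE expr2 mulrACA bb sqrtCN_mul uE mulrN1 mulrNN.
  by rewrite -[RHS]/((D * d)%:R) natrM.
move/intr_inj => /(congr1 absz); rewrite abszX absz_nat => /esym e.
have DD := squarefree_sqr_eq1 sqf Dd e (ltnW (ltnW (ltnW (ltnW d4)))).
by rewrite DD ltnn in Dlt.
Qed.

(** By Bezout [gcdn g j] also annihilates [a], so it cannot be a proper divisor of [g]. *)
Lemma mulrn_eq0_dvdn (G : zmodType) (g : nat) (a : G) : (1 < g)%N -> a *+ g = 0 ->
  (forall e, (0 < e)%N -> (e %| g)%N -> (e < g)%N -> a *+ e <> 0) ->
  forall j, a *+ j = 0 -> (g %| j)%N.
Proof.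
move=> g1 ag ne j aj.
have g0 : (0 < g)%N := ltnW g1.
have e0 : (0 < gcdn g j)%N by rewrite gcdn_gt0 g0.
have := ne _ e0 (dvdn_gcdl _ _).
rewrite ltn_neqAle dvdn_leq ?dvdn_gcdl // andbT.
have [gE _|gE] := eqVneq (gcdn g j) g; first by rewrite -gE dvdn_gcdr.
move=> /(_ isT) []; have [u v uv _] := egcdnP j g0.
by have := congr1 (fun x => a *+ x) uv; rewrite mulrnDr !(mulnC _ g) !(mulnC _ j) !mulrnA ag aj !mul0rn add0r => <-.
Qed.

Lemma class_group_embeds (d l g m n y : nat) (p : 'I_l -> nat) :
  squarefree d -> (4 < d)%N -> odd g -> (1 < g)%N -> (1 < m)%N ->
  coprime m n.*2 -> (m ^ g = n ^ 2 + y ^ 2 * d)%N -> (64 * m ^ g < d ^ 3)%N ->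
  injective p -> (forall i, prime (p i)) ->
  (\prod_i p i %| d)%N -> (\prod_i p i < d)%N ->
  embeds ('rV['Z_2]_l * 'Z_g)%type (class_group d).
Proof.
move=> sqf d4 og g1 m1 cop e bnd pinj pp pd plt.
have [a [ag a_ne]] := class_of_order sqf og m1 cop e bnd.
have [c [c2 cS]] := two_torsion_embeds sqf d4 pinj pp pd plt.
have aj := mulrn_eq0_dvdn g1 ag a_ne.
have amod j : a *+ (j %% g) = a *+ j.
  by rewrite [in RHS](divn_eq j g) mulrnDr mulnC mulrnA ag mul0rn add0r.
have cmod i j : c i *+ (j %% 2) = c i *+ j.
  by rewrite [in RHS](divn_eq j 2) mulrnDr mulnC mulrnA c2 mul0rn add0r.
pose f (x : 'rV['Z_2]_l * 'Z_g) : class_group d :=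
  \sum_i c i *+ (x.1 0 i : nat) + a *+ (x.2 : nat).
have Zg2 : (Zp_trunc g).+2 = g by rewrite Zp_cast.
have amod' j : a *+ (j %% (Zp_trunc g).+2) = a *+ j by rewrite Zg2 amod.
have fD : {morph f : x y / x + y}.
  move=> x x'; rewrite /f /= addrACA -big_split /=; congr (_ + _).
    by apply: eq_bigr => i _; rewrite mxE /= cmod mulrnDr.
  by rewrite /= amod' mulrnDr.
have f0 : f 0 = 0 by apply: (addIr (f 0)); rewrite -fD !add0r.
pose fA := GRing.isNmodMorphism.Build _ _ f (f0, fD).
pose F : {additive ('rV['Z_2]_l * 'Z_g)%type -> class_group d} := HB.pack f fA.
exists F; apply: raddf_inj => x; rewrite /F /= /f => fx.
(* Doubling an element of the kernel removes its 2-torsion part; as [g] is odd, the ['Z_g]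
   coordinate vanishes first. *)
have two : (\sum_i c i *+ (x.1 0 i : nat)) *+ 2 = 0.
  rewrite -sumrMnl big1 // => i _; by rewrite mulrnAC c2 mul0rn.
have x2 : x.2 = 0.
  have : a *+ (2 * (x.2 : nat)) = 0.
    rewrite mulnC mulrnA -[LHS]add0r -two -mulrnDl fx mul0rn //.
  move=> /aj; rewrite Gauss_dvdr; last by rewrite coprimen2.
  move=> /dvdnP[q qE]; apply/val_inj => /=.
  by have := leq_trans (ltn_ord x.2) (eq_leq Zg2); case: q qE => [//|q]; rewrite mulSn; lia.
have x1 : x.1 = 0.
  have := cS [set i | x.1 0 i != 0].
  have -> : \sum_(i in [set i | x.1 0 i != 0]) c i = \sum_i c i *+ (x.1 0 i : nat).
    rewrite big_mkcond /=; apply: eq_bigr => i _; rewrite inE.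
    by case: (x.1 0 i) => -[|[|//]] h.
  move: fx; rewrite x2 /= mulr0n addr0 => fx /(_ fx) S0.
  apply/rowP => i; rewrite mxE; apply/eqP; apply/negPn/negP => xi.
  by have : i \in [set i | x.1 0 i != 0]; [rewrite inE|rewrite S0 inE].
by rewrite [x]surjective_pairing x1 x2.
Qed.

Local Open Scope nat_scope.

(** * The asymptotic lower bound *)

Lemma odd_primes_exist l : exists p : 'I_l -> nat,
  [/\ injective p, forall i, prime (p i), odd (\prod_i p i) & squarefree (\prod_i p i)].
Proof.
pose nxt m := s2val (prime_above m).
have nxt_gt m : m < nxt m by rewrite /nxt; case: prime_above.
have nxt_prime m : prime (nxt m) by rewrite /nxt; case: prime_above.
(* Starting above 2 makes every prime odd. *)
pose q n := iter n.+1 nxt 2.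
have q_lt : {homo q : i j / i < j}.
  by apply: homo_ltn => [|n]; [exact: ltn_trans|rewrite /q [in X in _ < X]iterS].
have q_gt2 n : 2 < q n by elim: n => [|n IH]; [exact: nxt_gt|exact: ltn_trans IH (q_lt _ _ _)].
have q_inj : injective q.
  by move=> i j e; case: (ltngtP i j) => // /q_lt; rewrite e ltnn.
have q_prime n : prime (q n) by rewrite /q iterS.
exists (fun i => q i); split=> //.
- by move=> i j /q_inj/val_inj.
- elim/big_rec: _ => // i x _ ox; rewrite oddM ox andbT.
  by case/even_prime: (q_prime i) => // q2; have := q_gt2 i; rewrite q2.
move=> m mP.
have P0 : 0 < \prod_(i < l) q i by rewrite prodn_gt0 // => i; exact: prime_gt0.
have m0 : 0 < m by case: m mP => //; rewrite dvd0n => /eqP e; rewrite e in P0.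
apply/eqP; rewrite eqn_leq m0 andbT leqNgt; apply/negP => m1.
have pp := pdiv_prime m1; set p := pdiv m in pp.
have : p ^ 2 %| \prod_(i < l) q i.
  by apply: dvdn_trans mP; rewrite dvdn_exp2r // pdiv_dvd.
rewrite pfactor_dvdn //.
have [-> _] : logn p (\prod_(i < l) q i) = \sum_(i < l) (p == q i) /\ 0 < \prod_(i < l) q i.
  elim/big_rec2: _ => [|i x y _ [E y0]]; first by rewrite logn1.
  by rewrite (lognM _ (prime_gt0 (q_prime i)) y0) logn_prime // E muln_gt0 y0 prime_gt0.
have -> : \sum_(i < l) (p == q i) = #|[set i : 'I_l | p == q i]|.
  by rewrite -sum1_card [RHS]big_mkcond /=; apply: eq_bigr => i _; rewrite inE; case: eqP.
rewrite leqNgt ltnS => /negP; apply.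
apply/card_le1_eqP => i j; rewrite !inE => /eqP pi /eqP pj.
by apply/val_inj/q_inj; rewrite /= -pi -pj.
Qed.

Lemma many_class_groups (l g k : nat) : odd g -> 2 < g -> g + 30 <= k ->
  exists B0, forall B, B0 <= B ->
    exists D : {set 'I_(B ^ ((4 * g + 4) * k + 4)).+1},
      B ^ ((2 * g + 8) * k - (4 * g + 59)) <= #|D| /\
      forall d, d \in D -> [/\ 1 < d, squarefree d &
        embeds ('rV['Z_2]_l * 'Z_g)%type (class_group d)].
Proof.
move=> g_odd g2 kg.
have [p [p_inj p_prime P_odd P_sqf]] := odd_primes_exist l.
set P := \prod_i p i in P_odd P_sqf.
(* The shifts by 2 give [a, b <= B ^ (3 * k)] and [t <= B ^ ((g - 2) * k)]. With these sizes [om]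
   and [pi] in the collision estimate share the leading term [(2 * g + 8) * k]. *)
pose al := 3 * k - 2; pose th := (g - 2) * k - 2; pose e := g * al - (th + 18).
have alE : al + 2 = 3 * k by rewrite /al; lia.
have gkE : (g - 2) * k + 2 * k = g * k by rewrite -mulnDl subnK // ltnW.
have k_le : k <= (g - 2) * k by rewrite leq_pmull // subn_gt0.
have thE : th + 2 + 2 * k = g * k by rewrite /th; lia.
have galE : g * al + 2 * g = 3 * (g * k).
  by have := congr1 (muln g) alE; rewrite mulnDr; lia.
have eE : e + th + 18 = g * al by rewrite /e; lia.
have eE' : e + 2 * g + 16 = 2 * (g * k) + 2 * k by lia.
have gk_ge : 3 * k <= g * k by rewrite leq_mul2r g2 orbT.
have alg : (2 * al + 4) * g = 6 * (g * k).
  have -> : 2 * al + 4 = 6 * k by lia.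
  by rewrite -mulnA [k * g]mulnC.
have [b1 Hb1] := card_primes_ge al.
have [b2 Hb2] := card_primes_ge th.
have [b3 Hb3] := tau_le_base ((th + 17) * 2 + (2 * al + 4) * g).
exists (b1 + b2 + b3 + 4 * P ^ 2 + 65) => B hB.
have H1 := Hb1 B (ltac:(lia)); have H2 := Hb2 B (ltac:(lia)).
have H3 n : 0 < n -> n <= (B ^ (th + 17)) ^ 2 * B ^ ((2 * al + 4) * g) -> tau n <= B.
  by move=> n0; rewrite -expnM -expnD; apply: Hb3 => //; lia.
have al0 : 0 < al by lia.
have th0 : 0 < th by lia.
have e0 : 0 < e by lia.
have nuE : (e + th + 17).+1 = g * al by lia.
have h3 : (2 * al + 4) * g <= 3 * e by rewrite alg; lia.
have h4 : 2 * th + 31 <= 2 * e by lia.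
have h5 : e <= 2 * al + 2 * th + 37 by lia.
have Bgt : 4 * P ^ 2 < B by lia.
have B64 : 64 < B by lia.
have cnt := card_good_part_ge g_odd P_sqf P_odd al0 th0 e0 nuE h3 h4 h5 Bgt B64 H1 H2 H3.
have prop := good_partP g_odd P_sqf P_odd al0 th0 e0 nuE h3 h4 h5 Bgt B64 H1 H2 H3.
have -> : (4 * g + 4) * k + 4 = (2 * al + 4) * g - 2 * th.
  by rewrite alg mulnDl -mulnA; clear -thE; lia.
have -> : (2 * g + 8) * k - (4 * g + 59) = 2 * e - (2 * th + 31).
  by rewrite mulnDl -mulnA; clear -thE eE'; lia.
eexists; split; first exact: cnt.
move=> d /imsetP[x xG ->]; have /= [sqf dB Pd [m [n [y [m1 cop E bnd]]]]] := prop x xG.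
have P0 : 0 < P by case: P P_odd {P_sqf Bgt Pd hB prop cnt xG}.
have P_lt : P < good_part g th x.
  apply: leq_ltn_trans dB; apply: leq_trans (ltnW Bgt).
  by rewrite -mulnn mulnA leq_pmull // muln_gt0 P0.
have d4 : 4 < good_part g th x by apply: ltn_trans dB; apply: leq_trans B64.
split=> //; first by apply: leq_trans d4.
exact: (class_group_embeds sqf d4 g_odd (ltnW g2) m1 cop E bnd p_inj p_prime Pd P_lt).
Qed.

Local Open Scope ring_scope.

(** * From powers of [B] to a real bound [X] *)

Lemma card_le_class_count (R : realType) (H : zmodType) (X : R) (n : nat)
    (D : {set 'I_n.+1}) : (n <= Num.truncn X)%N ->
  (forall d, d \in D -> [/\ (1 < d)%N, squarefree d & embeds H (class_group d)]) ->
  (#|D| <= class_count H X)%N.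
Proof.
move=> nX DP; rewrite /class_count sum1_count -size_filter cardE -(size_map val).
apply: uniq_leq_size; first by rewrite map_inj_uniq ?enum_uniq //; apply: val_inj.
move=> _ /mapP[d dD ->]; rewrite mem_enum in dD; have [d1 sqf emb] := DP d dD.
have dn : (d <= n)%N by rewrite -ltnS.
rewrite mem_filter mem_index_iota d1 ltnS (leq_trans dn nX) !andbT.
exact/asboolP.
Qed.

(** [B] is the integer part of [r = X ^ (1 / K)]. Since [B >= 1], [r <= 2 * B], which explains the
    factor [2 ^+ w]. *)
Lemma powR_le_of_root (R : realType) (X t : R) (K w B0 : nat) : (0 < K)%N ->
  t * K%:R <= w%:R -> (B0.+1%:R) ^+ K <= X ->
  exists B : nat, [/\ (B0 <= B)%N, (B ^ K <= Num.truncn X)%N &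
    (2 ^+ w)^-1 * X `^ t <= (B ^ w)%:R].
Proof.
move=> K0 tK BX.
have K0R : (0 : R) < K%:R by rewrite ltr0n.
have X1 : 1 <= X by apply: le_trans BX; rewrite exprn_ege1 // ler1n.
have X0 : 0 <= X by apply: le_trans X1.
pose r := X `^ (K%:R^-1); have r0 : 0 <= r := powR_ge0 _ _.
have rK : r ^+ K = X.
  by rewrite -powR_mulrn // /r -powRrM mulVf ?gt_eqF // powRr1.
have rB : B0.+1%:R <= r.
  rewrite leNgt; apply/negP => h; move: BX; rewrite -rK leNgt => /negP; apply.
  by rewrite ltrXn2r ?gt_eqF.
exists (Num.truncn r); split.
- by rewrite truncn_ge_nat // (le_trans _ rB) // ler_nat.
- rewrite truncn_ge_nat // natrX -rK lerXn2r ?nnegrE ?ler0n //.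
  by rewrite truncn_le.
rewrite ler_pdivrMl ?exprn_gt0 // natrX -exprMn.
apply: (@le_trans _ _ (r ^+ w)).
  rewrite -powR_mulrn // /r -powRrM; apply: ler_powR => //.
  by rewrite mulrC ler_pdivlMr.
rewrite lerXn2r ?nnegrE //; first by rewrite mulr_ge0.
have /andP[h1 h2] := truncn_itv r0.
have : (1 : R) <= (Num.truncn r)%:R.
  by rewrite ler1n truncn_ge_nat // (le_trans _ rB) // ler1n.
by move: h2; rewrite -natr1; lra.
Qed.

Theorem theorem2p1 (R : realType) (l g1 : nat) (hl : (2 <= l)%N)
    (hg1 : (3 <= g1)%N) (hodd : odd g1) (eps : R) (heps : 0 < eps) :
  eventually_gg
    (fun X : R => (class_count ('rV['Z_2]_l * 'Z_g1)%type X)%:R)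
    (fun X : R => X `^ (1 / 2 + 3 / (2 * g1%:R + 2) - eps)).
Proof.
(* The ratio of [(2 * g1 + 8) * k] to [(4 * g1 + 4) * k] is the required exponent without [eps]. The
   lower-order terms [4 * g1 + 59] and [2 + 6 / (g1 + 1) <= 4] add up to at most [4 * g1 + 63],
   which [k * eps] must outweigh. *)
pose k := (g1 + 30 + (Num.truncn ((4 * g1 + 63)%:R / eps)).+1)%N.
have k_ge : (4 * g1 + 63)%:R <= k%:R * eps.
  rewrite -ler_pdivrMr //; apply: le_trans (ltW (truncnS_gt _)) _.
  by rewrite ler_nat leq_addl.
have gk : (g1 + 30 <= k)%N by rewrite leq_addr.
clearbody k; have [B0 HB] := many_class_groups l hodd hg1 gk.
set K := ((4 * g1 + 4) * k + 4)%N in HB; set w := ((2 * g1 + 8) * k - (4 * g1 + 59))%N in HB.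
exists (2 ^+ w)^-1; first by rewrite invr_gt0 exprn_gt0.
exists (B0.+1%:R ^+ K); split; first exact: num_real.
move=> X /ltW XB.
have K0 : (0 < K)%N by rewrite addn_gt0 orbT.
have tK : (1 / 2 + 3 / (2 * g1%:R + 2) - eps) * K%:R <= w%:R.
  have wE : w%:R = (2 * g1%:R + 8) * k%:R - (4 * g1%:R + 59) :> R.
    have le : (4 * g1 + 59 <= (2 * g1 + 8) * k)%N by clear -gk hg1; nia.
    by rewrite /w (natrB _ le) !(natrM, natrD).
  have KE : K%:R = (4 * g1%:R + 4) * k%:R + 4 :> R by rewrite !(natrD, natrM).
  have g3 : (3 : R) <= g1%:R by rewrite ler_nat.
  have k0 : (0 : R) <= k%:R by [].
  rewrite wE KE; move: k_ge; rewrite natrD natrM.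
  move: g3 k0; move: (g1%:R : R) (k%:R : R) => x y x3 y0 h.
  have -> : (1 / 2 + 3 / (2 * x + 2) - eps) * ((4 * x + 4) * y + 4) =
    (2 * x + 8) * y + (2 + 6 / (x + 1)) - eps * ((4 * x + 4) * y + 4).
    by field; lra.
  have : 6 / (x + 1) <= 2 by rewrite ler_pdivrMr; lra.
  have : y * eps <= eps * ((4 * x + 4) * y + 4) by nra.
  by move: h; lra.
have [B [BB BX le]] := powR_le_of_root K0 tK XB.
have [D [Dcard DP]] := HB B BB.
apply: le_trans le _; rewrite ler_nat; apply: leq_trans Dcard _.
exact: card_le_class_count BX DP.
Qed.
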